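(* The infinite word $\mathbf{q}$ is a Rote word with the optimal critical exponent $5/2$. That is: $\rho_{\mathbf{q}}(n)=2n$ for all $n\geq 1$; $\operatorname{ce}(\mathbf{q})=5/2$; and this value is the least possible among Rote words, i.e., the repetition threshold $\inf\{\operatorname{ce}(\mathbf{x}) : \mathbf{x} \text{ an infinite Rote word}\}$ of the class of infinite Rote words equals $5/2$.
   Context: Words are sequences over a finite alphabet, indexed from $0$. A factor of a word is a contiguous block occurring in it. For an infinite word $\mathbf{x}$, the factor complexity $\rho_{\mathbf{x}}(n)$ is the number of distinct factors of length $n$ of $\mathbf{x}$. An infinite Rote word is an infinite word $\mathbf{x}$ over $\{0,1\}$ with $\rho_{\mathbf{x}}(n)=2n$ for all $n\ge 1$. A nonempty finite word $z=z[0..n-1]$ of length $n$ has period $p$, where $1\le p\le n$, if $z[i]=z[i+p]$ for all $0\le i<n-p$. The exponent $\exp(z)$ is the length of $z$ divided by its shortest period. The critical exponent $\operatorname{ce}(\mathbf{x})$ of an infinite word $\mathbf{x}$ is the supremum of $\exp(z)$ over all nonempty finite factors $z$ of $\mathbf{x}$. The repetition threshold of a set $S$ of infinite words is $\inf_{\mathbf{x}\in S}\operatorname{ce}(\mathbf{x})$. Let $h$ be the morphism on $\{0,1,2\}^*$ defined by $h(0)=01$, $h(1)=21$, $h(2)=0$, and let $\mathbf{p}=012102101021012101021\cdots$ be its infinite fixed point starting with $0$, i.e., $\mathbf{p}=\lim_{k\to\infty}h^k(0)$. Let $g:\{0,1,2\}^*\to\{0,1\}^*$ be the morphism defined by $g(0)=011$,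 $g(1)=0$, $g(2)=01$. Define $\mathbf{q}=g(\mathbf{p})$. *)

(* Defs.v *)
From HB Require Import structures.
From mathcomp Require Import all_boot all_order all_algebra.
From mathcomp Require Import boolp classical_sets reals constructive_ereal ereal.

Set Implicit Arguments.
Unset Strict Implicit.
Unset Printing Implicit Defensive.

(** Finite words over [A] are of type [seq A], infinite words of type
    [nat -> A]; both are indexed from 0. *)

Section Words.
Variable A : finType.
Implicit Types (z w : seq A) (x : nat -> A) (S : set (nat -> A)).

Definition is_factor w x : Prop :=
  exists i : nat, w = mkseq (fun j => x (i + j)) (size w).

Definition complexity x n : nat :=
  #|[pred w : n.-tuple A | `[< is_factor w x >]]|.

Definition has_period z p : bool :=
  (0 < p <= size z) &&
  [forall i : 'I_(size z - p), onth z i == onth z (i + p)].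

(** Meaningful for nonempty [z] only, [size z] being then a period of [z];
    the empty word gets the junk value 0. *)
Definition shortest_period z : nat :=
  [arg min_(p < (ord_max : 'I_(size z).+1) | has_period z p) (p : nat)].

Lemma shortest_periodP z : z != [::] ->
  has_period z (shortest_period z) /\
  forall p, has_period z p -> shortest_period z <= p.
Proof.
move=> z0; have pz : has_period z (ord_max : 'I_(size z).+1).
  rewrite /has_period /= leqnn lt0n size_eq0 z0 /=.
  by apply/forallP => -[i Hi]; move: (Hi); rewrite subnn.
rewrite /shortest_period; case: arg_minnP => // p hp min_p; split=> // r hr.
have ltr : r < (size z).+1 by case/andP: hr => /andP[].
exact: (min_p (Ordinal ltr)).
Qed.

Definition exponent (R : realType) z : R :=
  ((size z)%:R / (shortest_period z)%:R)%R.

Definition critical_exponent (R : realType) x : \bar R :=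
  ereal_sup [set (exponent R z)%:E |
              z in [set z | z != [::] /\ is_factor z x]]%classic.

Definition repetition_threshold (R : realType) S : \bar R :=
  ereal_inf [set critical_exponent R x | x in S]%classic.

End Words.

Definition is_rote (x : nat -> 'I_2) : Prop :=
  forall n, 1 <= n -> complexity x n = 2 * n.

(** The morphism from [A^*] to [B^*] given by its values on letters. *)
Definition morph (A B : Type) (f : A -> seq B) (w : seq A) : seq B :=
  flatten (map f w).

Lemma morph_cat (A B : Type) (f : A -> seq B) u v :
  morph f (u ++ v) = morph f u ++ morph f v.
Proof. by rewrite /morph map_cat flatten_cat. Qed.

(** The limit of a sequence of finite words, each a prefix of the next and the
    [k]-th one of length greater than [k] (see [lim_wordP]); [b0] is a dummy. *)
Definition lim_word (B : Type) (b0 : B) (s : nat -> seq B) : nat -> B :=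
  fun n => nth b0 (s n) n.

Lemma lim_wordP (B : eqType) (b0 : B) (s : nat -> seq B) :
  (forall k, prefix (s k) (s k.+1)) -> (forall k, k < size (s k)) ->
  forall k, s k = mkseq (lim_word b0 s) (size (s k)).
Proof.
move=> pre lts k; have mono m n : m <= n -> prefix (s m) (s n).
  move=> /subnK <-; elim: (n - m) => [|d IH]; first exact: prefix_refl.
  exact: prefix_trans IH (pre _).
have eq_nth m n i : m <= n -> i < size (s m) -> nth b0 (s n) i = nth b0 (s m) i.
  by move=> /mono /prefixP[t ->] lti; rewrite nth_cat lti.
apply: (@eq_from_nth _ b0); first by rewrite size_mkseq.
move=> i lti; rewrite nth_mkseq // /lim_word.
by have [le|/ltnW le] := leqP k i; [rewrite (eq_nth k i)|rewrite (eq_nth i k)].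
Qed.

(** The image of an infinite word under a non-erasing morphism. *)
Definition image_word (A B : Type) (b0 : B) (f : A -> seq B) (x : nat -> A) :
  nat -> B := lim_word b0 (fun k => morph f (mkseq x k.+1)).

Lemma image_wordP (A : Type) (B : eqType) (b0 : B) (f : A -> seq B)
    (x : nat -> A) : (forall a, 0 < size (f a)) ->
  forall k, morph f (mkseq x k) =
    mkseq (image_word b0 f x) (size (morph f (mkseq x k))).
Proof.
move=> f0 [|k] //.
have E m : morph f (mkseq x m.+1) = morph f (mkseq x m) ++ f (x m).
  by rewrite mkseqS -cats1 morph_cat /morph /= cats0.
apply: (lim_wordP b0 (s := fun k => morph f (mkseq x k.+1))) => {}k.
  by rewrite [X in prefix _ X]E prefix_prefix.
elim: k => [|k IH]; first by rewrite E size_cat ltn_addl.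
rewrite E size_cat; apply: leq_ltn_trans IH _.
by rewrite -[X in X < _]addn0 ltn_add2l.
Qed.

Definition bit0 : 'I_2 := @Ordinal 2 0 isT.
Definition bit1 : 'I_2 := @Ordinal 2 1 isT.
Definition trit0 : 'I_3 := @Ordinal 3 0 isT.
Definition trit1 : 'I_3 := @Ordinal 3 1 isT.
Definition trit2 : 'I_3 := @Ordinal 3 2 isT.

Definition h (a : 'I_3) : seq 'I_3 :=
  match val a with
  | 0 => [:: trit0; trit1]
  | 1 => [:: trit2; trit1]
  | _ => [:: trit0]
  end.

Definition g (a : 'I_3) : seq 'I_2 :=
  match val a with
  | 0 => [:: bit0; bit1; bit1]
  | 1 => [:: bit0]
  | _ => [:: bit0; bit1]
  end.

Definition p : nat -> 'I_3 := lim_word trit0 (fun k => iter k (morph h) [:: trit0]).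

Definition q : nat -> 'I_2 := image_word bit0 g p.

Lemma size_h a : 0 < size (h a).
Proof. by case: a => -[|[|[|]]]. Qed.

Lemma size_g a : 0 < size (g a).
Proof. by case: a => -[|[|[|]]]. Qed.

Lemma prefix_iter_h k :
  prefix (iter k (morph h) [:: trit0]) (iter k.+1 (morph h) [:: trit0]).
Proof.
elim: k => // k /prefixP[t E].
by rewrite [X in prefix _ X]iterS [in X in prefix _ X]E morph_cat prefix_prefix.
Qed.

Lemma size_iter_h k : k < size (iter k (morph h) [:: trit0]).
Proof.
have sz w : size w <= size (morph h w).
  elim: w => // a w IH.
  rewrite -[a :: w]cat1s morph_cat !size_cat; apply: leq_add => //.
  by rewrite /morph /= addn0 size_h.
suff [w [-> ?]] : exists w, iter k (morph h) [:: trit0] = trit0 :: w /\ k <= size w.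
  by [].
elim: k => [|k [w [E le]]]; first by exists [::].
exists (trit1 :: morph h w); rewrite iterS E; split=> //=.
by rewrite ltnS (leq_trans le).
Qed.

Lemma pP k : iter k (morph h) [:: trit0] =
  mkseq p (size (iter k (morph h) [:: trit0])).
Proof. exact: lim_wordP prefix_iter_h size_iter_h k. Qed.

Lemma p_fixed : image_word trit0 h p =1 p.
Proof.
move=> n; have := image_wordP trit0 p size_h (size (iter n (morph h) [:: trit0])).
rewrite -pP -iterS => /(congr1 (fun s => nth trit0 s n)).
have lt : n < size (iter n.+1 (morph h) [:: trit0]).
  exact: ltnW (size_iter_h n.+1).
by rewrite nth_mkseq // => <-; rewrite pP nth_mkseq.
Qed.

Lemma qP k : morph g (mkseq p k) = mkseq q (size (morph g (mkseq p k))).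
Proof. exact: image_wordP size_g k. Qed.

(* Main.v *)
Require Import Defs.
From mathcomp Require Import all_boot all_order all_algebra.
From mathcomp Require Import boolp classical_sets reals constructive_ereal ereal.
From mathcomp Require Import zify.

(** Both [p] and [q] are coded words: [p] is cut into the blocks [h (p k)], and
    a new block starts exactly at the letters other than 1; [q] is cut into the
    blocks [g (p k)], and a new block starts exactly at the letters 0.  A factor
    of either word can therefore be decoded, up to an incomplete block at each
    end, into a factor of [p].  Each of the first two claims reduces in this way
    to a statement about [p], proved by descent through [h].

    Complexity.  The difference of the complexities of [q] at [n.+1] and [n] is
    the number of right special factors of length [n] (those followed by both
    letters).  There are at least two, one ending with 0 and one ending with 1,
    because the images under [h] and [g] of right special factors of [p] are,
    after a completion by at most two letters, right special again
    ([rspecial_q]).  Removing the first letter of a right special factor leaves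
    a right special factor; this map is injective as soon as no nonempty factor
    is strong bispecial, that is, can be extended on both sides in the four
    possible ways ([no_strong_bispecial_q]).  So there are at most two right
    special factors of each positive length, since there are two of length 1,
    and the complexity is [2 * n].

    Critical exponent of [q].  A repetition of period [d] is an interval on
    which the word agrees with its shift by [d]; the exponent is at most 5/2 iff
    the length of this interval, the overlap, is at most 3/2 of the period.  An
    overlap of [q] or [p] with a long period decodes to an overlap of [p] with a
    smaller period, up to a few letters lost at the ends.  In [p] the asymptotic
    exponent is about 2.481, which leaves just enough room to absorb these
    letters: [slack_p] proves, separately for each letter, that the overlap
    contains less than 3/2 as many of them as the period, with a margin that
    records the letters which the next application of [h] can add.  Periods
    from 17 to 34 in [p] and up to 48 in [q] are checked on a list of all factors
    of bounded length ([all_windows]).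

    Optimality.  A binary word of length 39 contains a repetition of exponent at
    least 5/2 or has more than 10 factors of length 5 ([unavoidable39], a finite
    search), and a Rote word has exactly 10 of these.  Applied to [q] this also
    shows that the exponent 5/2 is attained. *)

Set Implicit Arguments.
Unset Strict Implicit.
Unset Printing Implicit Defensive.

Import Order.TTheory GRing.Theory Num.Theory.

(** * Windows of an infinite word *)
Definition fac (A : Type) (x : nat -> A) (i n : nat) : seq A :=
  mkseq (fun j => x (i + j)) n.

Section Windows.
Variable A : Type.
Implicit Type x : nat -> A.

Lemma size_fac x i n : size (fac x i n) = n.
Proof. exact: size_mkseq. Qed.

Lemma nth_fac a0 x i n j : j < n -> nth a0 (fac x i n) j = x (i + j).
Proof. exact: nth_mkseq. Qed.

Lemma fac0 x n : fac x 0 n = mkseq x n.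
Proof. by []. Qed.

Lemma facD x i m n : fac x i (m + n) = fac x i m ++ fac x (i + m) n.
Proof.
rewrite /fac /mkseq iotaD map_cat add0n; congr (_ ++ _).
rewrite -[m in iota m n]addn0 iotaDl -map_comp; apply: eq_map => j /=.
by rewrite addnA.
Qed.

Lemma facS x i n : fac x i n.+1 = x i :: fac x i.+1 n.
Proof. by rewrite -add1n facD /= addn1 addn0. Qed.

Lemma fac_rcons x i n : fac x i n.+1 = rcons (fac x i n) (x (i + n)).
Proof. by rewrite -addn1 facD cats1 /= addn0. Qed.

Lemma eq_fac x y i j n :
  (forall k, k < n -> x (i + k) = y (j + k)) -> fac x i n = fac y j n.
Proof.
elim: n i j => [//|n IH] i j E; rewrite !facS; congr (_ :: _).
  by have := E 0 isT; rewrite !addn0.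
by apply: IH => k lt; rewrite !addSnnS; apply: E.
Qed.

Lemma fac_inj x y i j n :
  fac x i n = fac y j n -> forall k, k < n -> x (i + k) = y (j + k).
Proof.
move=> E k lt; have := congr1 (fun s => nth (x 0) s k) E.
by rewrite !nth_fac.
Qed.

End Windows.

Lemma factor_fac (A : finType) (x : nat -> A) i n : is_factor (fac x i n) x.
Proof. by exists i; rewrite size_fac. Qed.

Lemma factor_catl (A : finType) (x : nat -> A) u v :
  is_factor (u ++ v) x -> is_factor u x.
Proof.
case=> i; rewrite -/(fac x i _) size_cat facD => /eqP.
by rewrite eqseq_cat ?size_fac // => /andP[/eqP E _]; exists i.
Qed.

Lemma factor_catr (A : finType) (x : nat -> A) u v :
  is_factor (u ++ v) x -> is_factor v x.
Proof.
case=> i; rewrite -/(fac x i _) size_cat facD => /eqP.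
by rewrite eqseq_cat ?size_fac // => /andP[_ /eqP E]; exists (i + size u).
Qed.

(** * Cutting points of a coded word *)

Section Coding.
Variables (A B : Type) (f : A -> seq B) (x : nat -> A) (y : nat -> B).
Hypothesis f_gt0 : forall a, 0 < size (f a).
Hypothesis xy : forall k,
  morph f (mkseq x k) = mkseq y (size (morph f (mkseq x k))).

(** The position in [y] at which the block of the [k]-th letter of [x] starts. *)
Definition pos k := size (morph f (mkseq x k)).

Lemma pos0 : pos 0 = 0. Proof. by []. Qed.

Lemma morph1 a : morph f [:: a] = f a.
Proof. exact: cats0. Qed.

Lemma posS k : pos k.+1 = pos k + size (f (x k)).
Proof. by rewrite /pos mkseqS -cats1 morph_cat size_cat morph1. Qed.

Lemma fac_pos k : fac y (pos k) (size (f (x k))) = f (x k).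
Proof.
have := xy k.+1; rewrite -/(pos _) posS -(fac0 y) facD add0n.
rewrite mkseqS -cats1 morph_cat morph1 => /(congr1 (drop (pos k))).
by rewrite !drop_size_cat ?size_fac.
Qed.

Lemma nth_pos b0 k j : j < size (f (x k)) -> y (pos k + j) = nth b0 (f (x k)) j.
Proof. by move=> lt; rewrite -fac_pos nth_fac. Qed.

Lemma pos_first b0 k : y (pos k) = head b0 (f (x k)).
Proof. by rewrite -nth0 -nth_pos // addn0. Qed.

Lemma pos_lt k : pos k < pos k.+1.
Proof. by rewrite posS -addn1 leq_add2l. Qed.

Lemma pos_ltn m n : m < n -> pos m < pos n.
Proof.
elim: n => // n IH; rewrite ltnS leq_eqVlt => /predU1P[->|/IH lt].
  exact: pos_lt.
exact: ltn_trans lt (pos_lt _).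
Qed.

Lemma pos_leq m n : m <= n -> pos m <= pos n.
Proof. by rewrite leq_eqVlt => /predU1P[->//|/pos_ltn/ltnW]. Qed.

Lemma pos_ge k : k <= pos k.
Proof. by elim: k => // k IH; apply: leq_ltn_trans IH (pos_lt k). Qed.

Lemma pos_find i : exists k, pos k <= i < pos k.+1.
Proof.
elim: i => [|i [k /andP[le lt]]]; first by exists 0; apply: (pos_lt 0).
have [lt'|ge] := ltnP i.+1 (pos k.+1); first by exists k; rewrite lt' ltnW.
by exists k.+1; rewrite ge; apply: leq_ltn_trans lt (pos_lt _).
Qed.

Lemma morph_fac k n :
  morph f (fac x k n) = fac y (pos k) (pos (k + n) - pos k).
Proof.
have le : pos k <= pos (k + n) by rewrite pos_leq ?leq_addr.
have := xy (k + n); rewrite -/(pos _) -{1}fac0 facD add0n morph_cat.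
rewrite -{1}(subnKC le) -(fac0 y) facD add0n => /(congr1 (drop (pos k))).
by rewrite !drop_size_cat ?size_fac // -/(pos k).
Qed.

End Coding.

Arguments pos {A B} f x k : simpl never.

(** * The words [p] and [q] *)

Lemma p_morph_h k : morph h (mkseq p k) = mkseq p (size (morph h (mkseq p k))).
Proof.
by rewrite [LHS](image_wordP trit0 p size_h k); apply: eq_mkseq; apply: p_fixed.
Qed.

Notation posh := (pos h p).
Notation posg := (pos g p).

Lemma trit_case (a : 'I_3) : [\/ a = trit0, a = trit1 | a = trit2].
Proof.
by case: a => -[|[|[|//]]] i; [apply: Or31|apply: Or32|apply: Or33]; apply: val_inj.
Qed.

Lemma bit_case (a : 'I_2) : a = bit0 \/ a = bit1.
Proof. by case: a => -[|[|//]] i; [left|right]; apply: val_inj. Qed.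

(** The pairs of consecutive letters of [p]: inside a block, 01 and 21; across two
    blocks, a last letter followed by a first letter. *)
Definition adj (a b : 'I_3) : bool :=
  (val a, val b) \in [:: (0, 1); (0, 2); (1, 0); (1, 2); (2, 1)].

Lemma p_prefix : mkseq p 6 =
  [:: trit0; trit1; trit2; trit1; trit0; trit2].
Proof.
have := congr1 (take 6) (pP 4); rewrite /mkseq -map_take take_iota => <-.
by apply/eqP; vm_compute.
Qed.

Lemma p_adj n : adj (p n) (p n.+1).
Proof.
elim/ltn_ind: n => n IH.
have p0 : p 0 = trit0 by [].
have [k /andP[le lt]] := pos_find p size_h n.
move: lt; rewrite posS; have nxt := pos_first size_h p_morph_h trit0 k.+1.
(* A pair across two blocks comes from a pair at an earlier position [k]: the
   inequality [k < posh k] holds for [k > 0] because the first block has length 2. *)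
have lk : k < n -> adj (p k) (p k.+1) by apply: IH.
have gek : 0 < k -> k < posh k.
  case: k {le nxt lk} => // k _; elim: k => [|k lk].
    by rewrite posS pos0 p0.
  by apply: leq_ltn_trans lk (pos_lt p size_h _).
have E j : j < size (h (p k)) -> p (posh k + j) = nth trit0 (h (p k)) j.
  exact: (nth_pos p_morph_h trit0).
rewrite posS in nxt.
case: (trit_case (p k)) => pk; rewrite pk in lk E nxt *.
all: move=> /= lt.
- have [en|en] : n = posh k + 0 \/ n = posh k + 1 by lia.
    by rewrite en -addnS !E.
  have/lk : k < n by have := pos_ge p size_h k; lia.
  rewrite en E // -addnS nxt.
  by case: (trit_case (p k.+1)) => ->.
- have [en|en] : n = posh k + 0 \/ n = posh k + 1 by lia.
    by rewrite en -addnS !E.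
  have/lk : k < n by have := pos_ge p size_h k; lia.
  rewrite en E // -addnS nxt.
  by case: (trit_case (p k.+1)) => ->.
- have en : n = posh k + 0 by lia.
  have/lk : k < n.
    have k0 : 0 < k by case: (k) pk => //; rewrite p0 => /eqP.
    by have := gek k0; lia.
  rewrite en E // -addnS nxt.
  by case: (trit_case (p k.+1)) => ->.
Qed.

(** A window of length [N] lies in the image of two consecutive letters when every
    image of a letter has length at least [N], and the five pairs of consecutive
    letters all occur in the first six letters of [p]. *)
Lemma recurrence (B : Type) (F : seq 'I_3 -> seq B) (y : nat -> B) N :
    (forall u v, F (u ++ v) = F u ++ F v) ->
    (forall n, F (mkseq p n) = mkseq y (size (F (mkseq p n)))) ->
    (forall a, N <= size (F [:: a])) -> 0 < N ->
  forall i, exists j, j + N <= size (F (mkseq p 6)) /\ fac y i N = fac y j N.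
Proof.
move=> Fcat Fy FN N0 i; pose P n := size (F (mkseq p n)).
have PS n : P n.+1 = P n + size (F [:: p n]).
  by rewrite /P mkseqS -cats1 Fcat size_cat.
have P0 : P 0 = 0.
  by apply/eqP; rewrite -(eqn_add2l (P 0)) addn0 -size_cat -Fcat.
have FS n : fac y (P n) (size (F [:: p n; p n.+1])) = F [:: p n; p n.+1].
  have := Fy n.+2; rewrite !mkseqS -!cats1 -catA Fcat.
  rewrite size_cat -(fac0 y) facD add0n => /(congr1 (drop (P n))).
  by rewrite !drop_size_cat ?size_fac.
have [n /andP[len ltn]] : exists n, P n <= i < P n.+1.
  elim: i => [|i [n /andP[le lt]]].
    by exists 0; rewrite PS P0 /=; apply: leq_trans (FN _).
  have [lt'|ge] := ltnP i.+1 (P n.+1); first by exists n; rewrite lt' ltnW.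
  exists n.+1; rewrite ge PS.
  by have := FN (p n.+1); lia.
have [m lem [e1 e2]] : exists2 m, m <= 4 & p m = p n /\ p m.+1 = p n.+1.
  have E m : m < 6 -> p m = nth trit0 (mkseq p 6) m by move=> lt; rewrite nth_mkseq.
  move: (p_adj n); case: (trit_case (p n)) => ->; case: (trit_case (p n.+1)) => -> // _.
  - by exists 0 => //; rewrite !E // p_prefix.
  - by exists 4 => //; rewrite !E // p_prefix.
  - by exists 3 => //; rewrite !E // p_prefix.
  - by exists 1 => //; rewrite !E // p_prefix.
  - by exists 2 => //; rewrite !E // p_prefix.
have Fc a b : size (F [:: a; b]) = size (F [:: a]) + size (F [:: b]).
  by rewrite -cat1s Fcat size_cat.
have r_lt : i - P n + N <= size (F [:: p n; p n.+1]).
  by rewrite Fc; have := FN (p n.+1); rewrite PS in ltn; lia.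
exists (P m + (i - P n)); split.
  have Pmono k : P k <= P k.+1 by rewrite PS leq_addr.
  have : P m.+2 <= P 6.
    by apply: (homo_leq (f := P) leqnn leq_trans) => //; lia.
  by rewrite (PS m.+1) (PS m) e1 e2; rewrite Fc in r_lt; rewrite -/(P 6); lia.
apply: eq_fac => k lt; have e : fac y (P n) (size (F [:: p n; p n.+1])) =
  fac y (P m) (size (F [:: p n; p n.+1])) by rewrite FS -e1 -e2 FS.
have := fac_inj e (k := i - P n + k); rewrite !addnA subnKC //; apply.
lia.
Qed.

(** * Overlaps and their desubstitution *)

(** [x] restricted to the interval from [a] to [c + d] has period [d]. *)
Definition agree (A : Type) (x : nat -> A) (d a c : nat) : Prop :=
  forall i, a <= i < c -> x i = x (i + d).

(** Two cutting points of the coded word at distance [d] are the starting point of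
    an agreement of the coding word [x] with shift [e].  Extended in both
    directions as far as possible, it stops either because the preimage covers
    the interval from [a] to [c], or at two distinct letters of [x], whose blocks
    are then to be compared. *)
Lemma desubst_agree (A : eqType) (B : Type) (f : A -> seq B) (x : nat -> A)
    (f_gt0 : forall a, 0 < size (f a)) (d e a c n : nat) :
    pos f x (n + e) = pos f x n + d ->
  exists n0 m0, [/\ n0 <= n <= m0, agree x e n0 m0,
    forall k, n0 <= k <= m0 -> pos f x (k + e) = pos f x k + d,
    pos f x n0 <= a \/ (0 < n0 /\ x n0.-1 <> x (n0.-1 + e)) &
    c <= pos f x m0 \/ x m0 <> x (m0 + e)].
Proof.
move=> En.
have [m0 [le_m agm endm]] : exists m0, [/\ n <= m0, agree x e n m0 &
    c <= pos f x m0 \/ x m0 <> x (m0 + e)].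
  suff H k : exists m0, [/\ n <= m0, agree x e n m0 &
    n + k <= m0 \/ x m0 <> x (m0 + e)].
    have [m0 [le_m agm endm]] := H c; exists m0; split=> //.
    case: endm => [le|]; [left|by right].
    by have := pos_ge x f_gt0 m0; lia.
  elim: k => [|k [m0 [le_m agm endm]]].
    by exists n; split=> [//|i|]; [lia|left; rewrite addn0].
  have [eq|ne] := eqVneq (x m0) (x (m0 + e)); last first.
    by exists m0; split=> //; right; apply/eqP.
  case: endm => // le; exists m0.+1; split.
  - by lia.
  - move=> i le_i; have [->//|neq] := eqVneq i m0.
    by apply: agm; lia.
  - by left; lia.
have [n0 [le_n agn endn]] : exists n0, [/\ n0 <= n, agree x e n0 n &
    pos f x n0 <= a \/ (0 < n0 /\ x n0.-1 <> x (n0.-1 + e))].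
  elim: (n) => [|k [n0 [le_n agn endn]]].
    by exists 0; split=> [//|i|]; [lia|left; rewrite pos0].
  have [le|lt] := leqP (pos f x k.+1) a.
    by exists k.+1; split=> [//|i|]; [lia|left].
  have [eq|ne] := eqVneq (x k) (x (k + e)); last first.
    by exists k.+1; split=> [//|i|]; [lia|right; split=> //; apply/eqP].
  exists n0; split=> //; first by lia.
  move=> i le_i; have [->//|neq] := eqVneq i k.
  by apply: agn; lia.
have ag : agree x e n0 m0.
  by move=> i le_i; have [lt|ge] := ltnP i n; [apply: agn|apply: agm]; lia.
exists n0, m0; split=> //; first by rewrite le_n.
have up j : n + j <= m0 -> pos f x (n + j + e) = pos f x (n + j) + d.
  elim: j => [|j IH] le; first by rewrite addn0.
  rewrite addnS addSn !posS -ag ?IH //; lia.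
have down j : j <= n - n0 -> pos f x (n - j + e) = pos f x (n - j) + d.
  elim: j => [|j IH] le; first by rewrite subn0.
  have E : n - j = (n - j.+1).+1 by lia.
  have := IH (ltnW le); rewrite E addSn !posS -ag; lia.
move=> k le_k; have [le|lt] := leqP n k.
  by have := @up (k - n); rewrite subnKC //; apply; lia.
by have := @down (n - k); rewrite subKn ?(ltnW lt) //; apply; lia.
Qed.

Definition cnt (x : nat -> 'I_3) (a : 'I_3) (i : nat) : nat :=
  count_mem a (mkseq x i).

Lemma cntS x a i : cnt x a i.+1 = cnt x a i + (x i == a).
Proof. by rewrite /cnt mkseqS -cats1 count_cat /= addn0. Qed.

Lemma cntD x a i n : cnt x a (i + n) = cnt x a i + count_mem a (fac x i n).
Proof. by rewrite /cnt -!fac0 facD count_cat add0n. Qed.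

Lemma cnt_morph f y a k : (forall k,
    morph f (mkseq p k) = mkseq y (size (morph f (mkseq p k)))) ->
  cnt y a (pos f p k) = cnt p trit0 k * count_mem a (f trit0) +
    cnt p trit1 k * count_mem a (f trit1) + cnt p trit2 k * count_mem a (f trit2).
Proof.
move=> fy; rewrite /cnt -fy; elim: k => // k IH.
rewrite mkseqS -!cats1 morph_cat morph1 !count_cat IH /=.
by case: (trit_case (p k)) => ->; rewrite !mulnDl /=; lia.
Qed.

Lemma cnt0_posh k : cnt p trit0 (posh k) = cnt p trit0 k + cnt p trit2 k.
Proof. by rewrite (cnt_morph _ _ p_morph_h) /=; lia. Qed.

Lemma cnt1_posh k : cnt p trit1 (posh k) = cnt p trit0 k + cnt p trit1 k.
Proof. by rewrite (cnt_morph _ _ p_morph_h) /=; lia. Qed.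

Lemma cnt2_posh k : cnt p trit2 (posh k) = cnt p trit1 k.
Proof. by rewrite (cnt_morph _ _ p_morph_h) /=; lia. Qed.

Lemma cnt_sum k : cnt p trit0 k + cnt p trit1 k + cnt p trit2 k = k.
Proof.
elim: k => // k IH; rewrite !cntS.
by case: (trit_case (p k)) => -> /=; lia.
Qed.

Lemma pos_cnt (B : Type) (f : 'I_3 -> seq B) k : pos f p k =
  cnt p trit0 k * size (f trit0) + cnt p trit1 k * size (f trit1) +
  cnt p trit2 k * size (f trit2).
Proof.
elim: k => // k IH; rewrite posS IH !cntS.
by case: (trit_case (p k)) => ->; rewrite !mulnDl /=; lia.
Qed.

(** The number of occurrences of a letter in a period does not depend on where
    the period is read, as long as one stays within the agreement. *)
Lemma agree_cnt x d a c i j u : agree x d a c -> a <= i -> i <= j -> j <= c ->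
  cnt x u (j + d) + cnt x u i = cnt x u (i + d) + cnt x u j.
Proof.
move=> ag ai ij jc; rewrite -(subnKC ij) in jc *.
elim: (j - i) jc => [|k IH] jc; first by rewrite addn0.
have le : i + k <= c by lia.
have E : x (i + k) = x (i + k + d) by apply: ag; lia.
by have := IH le; rewrite addnS addSn !cntS E; lia.
Qed.

(** * Overlaps of [p] *)

Definition pair01 (a b : 'I_3) : bool := (val a, val b) \in [:: (0, 1); (1, 0)].
Definition pair02 (a b : 'I_3) : bool := (val a, val b) \in [:: (0, 2); (2, 0)].

(** The next image under [h] of an overlap starting at [n] is one letter longer on
    the left exactly when the two letters that precede the agreeing words are 0
    and 1, since [h] maps these two letters, and no other pair, to blocks with
    a common last letter. *)
Definition left_ext (n d : nat) : bool := (0 < n) && pair01 (p n.-1) (p (n.-1 + d)).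
(** On the right the same happens for 0 and 2, whose blocks have the common first
    letter 0. *)
Definition right_ext (m d : nat) : bool := pair02 (p m) (p (m + d)).

(** With [v] the period and [x] the overlap from [n] to [m], the three inequalities
    say that [2 * count_mem a x + 1 + b <= 3 * count_mem a v] for each letter [a].
    The margin [1 + b] is chosen so as to reproduce itself under [h]: an overlap
    to which [h] adds the letter 1 on the left, or the letter 0 on the right,
    needs one more unit for this letter, and [h] does not add a letter on the
    same side of its image. *)
Definition slack (n m d : nat) : Prop :=
  [/\ 2 * cnt p trit0 m + cnt p trit0 n + right_ext m d < 3 * cnt p trit0 (n + d),
      2 * cnt p trit1 m + cnt p trit1 n + left_ext n d < 3 * cnt p trit1 (n + d) &
      2 * cnt p trit2 m + cnt p trit2 n < 3 * cnt p trit2 (n + d)].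

(** Checks the inequalities of [slack] for all overlaps starting at the head of
    [s], where [t] is [s] without its first period: the budgets [b0], [b1], [b2]
    are initially three times the letter counts of the period, and each letter
    of the overlap costs two. *)
Fixpoint spend (L : bool) (s t : seq 'I_3) (b0 b1 b2 : nat) : bool :=
  match s, t with
  | a :: s', b :: t' =>
    [&& pair02 a b < b0, L < b1, 0 < b2 &
      if val a == val b then
        match val a with
        | 0 => spend L s' t' b0.-2 b1 b2
        | 1 => spend L s' t' b0 b1.-2 b2
        | _ => spend L s' t' b0 b1 b2.-2
        end
      else true]
  | _, _ => true
  end.

Definition budget (a : 'I_3) (s : seq 'I_3) (d : nat) : nat :=
  3 * count (fun b => val b == val a) (take d s).

Definition check_from (lo n : nat) (L : nat -> bool) (s : seq 'I_3) : bool :=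
  all (fun d => spend (L d) s (drop d s)
         (budget trit0 s d) (budget trit1 s d) (budget trit2 s d)) (iota lo n).

(** The first letter of the window is the one that precedes the overlap. *)
Definition check_window (lo n : nat) (w : seq 'I_3) : bool :=
  if w is a :: s then check_from lo n (fun d => pair01 a (nth trit0 s d.-1)) s
  else true.

Lemma take_fac (A : Type) (x : nat -> A) i m n : m <= n ->
  take m (fac x i n) = fac x i m.
Proof. by move=> /subnKC <-; rewrite facD take_size_cat ?size_fac. Qed.

Lemma drop_fac (A : Type) (x : nat -> A) i m n : m <= n ->
  drop m (fac x i n) = fac x (i + m) (n - m).
Proof. by move=> le; rewrite -{1}(subnKC le) facD drop_size_cat ?size_fac. Qed.

(** The image of the prefix of length 6 of [p]; see [recurrence]. *)
Definition sample (B : Type) (F : seq 'I_3 -> seq B) : seq B :=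
  F [:: trit0; trit1; trit2; trit1; trit0; trit2].

Lemma all_windows (B : Type) (F : seq 'I_3 -> seq B) (y : nat -> B) N
    (P : seq B -> bool) :
    (forall u v, F (u ++ v) = F u ++ F v) ->
    (forall n, F (mkseq p n) = mkseq y (size (F (mkseq p n)))) ->
    (forall a, N <= size (F [:: a])) -> 0 < N ->
    all (fun j => P (take N (drop j (sample F)))) (iota 0 (size (sample F) - N).+1) ->
  forall i, P (fac y i N).
Proof.
move=> Fcat Fy FN N0 PP i; have [j [jN ->]] := recurrence Fcat Fy FN N0 i.
have := allP PP j; rewrite mem_iota add0n ltnS /sample -p_prefix.
have -> : j <= size (F (mkseq p 6)) - N by lia.
move=> /(_ isT).
by rewrite Fy -fac0 drop_fac ?take_fac ?add0n //; lia.
Qed.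

Lemma spendP L s t b0 b1 b2 l : spend L s t b0 b1 b2 ->
    l < size s -> l < size t ->
    (forall k, k < l -> nth trit0 s k = nth trit0 t k) ->
  [/\ 2 * count_mem trit0 (take l s) + pair02 (nth trit0 s l) (nth trit0 t l) < b0,
      2 * count_mem trit1 (take l s) + L < b1 &
      2 * count_mem trit2 (take l s) < b2].
Proof.
elim: l s t b0 b1 b2 => [|l IH] [|a s] [|b t] b0 b1 b2 //=.
  by case/and4P.
move=> W ls lt E; have ab := E 0 isT; rewrite /= in ab; subst b.
move: W; rewrite eqxx; case: (trit_case a) => ->.
all: case/and4P=> B0 B1 B2 /= /IH /(_ ls lt (fun k => E k.+1)) [H0 H1 H2].
all: move: H0 H1 H2; move: (nat_of_bool (pair02 (nth _ _ _) _)).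
all: move: (count_mem trit0 _) (count_mem trit1 _) (count_mem trit2 _).
all: by clear; move=> ? ? ? ? ? ? ?; split; lia.
Qed.

Lemma budgetE a s d : budget a s d = 3 * count_mem a (take d s).
Proof. by []. Qed.

Lemma check_fromP lo c L i N m d : check_from lo c L (fac p i N) ->
    lo <= d < lo + c -> i <= m -> m - i + d < N -> agree p d i m ->
  [/\ 2 * cnt p trit0 m + cnt p trit0 i + right_ext m d < 3 * cnt p trit0 (i + d),
      2 * cnt p trit1 m + cnt p trit1 i + L d < 3 * cnt p trit1 (i + d) &
      2 * cnt p trit2 m + cnt p trit2 i < 3 * cnt p trit2 (i + d)].
Proof.
move=> /allP/(_ d); rewrite mem_iota !budgetE => W /W {W} + im lN ag.
rewrite drop_fac; last by lia.
move=> /(@spendP _ _ _ _ _ _ (m - i)); rewrite !size_fac !take_fac; try lia.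
rewrite !nth_fac; try lia.
have -> : i + d + (m - i) = m + d by lia.
rewrite subnKC // -/(right_ext m d).
case; try lia.
  move=> k lt; rewrite !nth_fac; try lia.
  by rewrite addnAC; apply: ag; lia.
have E u : cnt p u m = cnt p u i + count_mem u (fac p i (m - i)).
  by rewrite -cntD subnKC.
rewrite !E !cntD => H0 H1 H2.
by split; lia.
Qed.

Lemma iter_h_cat j u v : iter j (morph h) (u ++ v) =
  iter j (morph h) u ++ iter j (morph h) v.
Proof. by elim: j => // j IH; rewrite !iterS IH morph_cat. Qed.

Lemma iter_h_p j k : iter j (morph h) (mkseq p k) =
  mkseq p (size (iter j (morph h) (mkseq p k))).
Proof. by elim: j => [|j IH]; [rewrite size_mkseq|rewrite iterS IH -p_morph_h]. Qed.

(** 104 is large enough for an overlap of length [2 * d] and a period [d <= 34], with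
    one more letter on each side. *)
Lemma size_iter_h9 a : 104 <= size (iter 9 (morph h) [:: a]).
Proof. by case: (trit_case a) => ->; vm_compute. Qed.

Lemma check_base : forall i, check_window 17 18 (fac p i 104).
Proof.
apply: (all_windows (iter_h_cat 9) (iter_h_p 9) size_iter_h9 isT).
by vm_compute.
Qed.

(** An overlap at the very beginning of [p] is not preceded by any letter. *)
Lemma check_base0 : check_from 17 18 (fun=> false) (fac p 0 104).
Proof.
have -> : fac p 0 104 = take 104 (iter 9 (morph h) [:: trit0]).
  have := iter_h_p 9 1; rewrite [mkseq p 1]/= => E.
  by have := size_iter_h9 trit0; rewrite E fac0 size_mkseq => le; rewrite -!fac0 take_fac.
by vm_compute.
Qed.

Lemma slack_base_short n m d : 17 <= d <= 34 -> n <= m -> m - n <= 2 * d ->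
  agree p d n m -> slack n m d.
Proof.
move=> dd nm short ag.
case: n nm short ag => [|i] nm short ag.
  by apply: (check_fromP check_base0) => //; lia.
have := check_base i; rewrite facS /= => /(@check_fromP _ _ _ _ _ m d).
rewrite nth_fac; last by lia.
have -> : i.+1 + d.-1 = i + d by lia.
by case; try lia; try exact: ag.
Qed.

(** A longer overlap would have a prefix of length [2 * d], which already violates
    [slack]: adding up its inequalities gives a length less than [3 * d / 2]. *)
Lemma slack_base n m d : 17 <= d <= 34 -> n <= m -> agree p d n m -> slack n m d.
Proof.
move=> dd nm ag; pose m' := minn m (n + 2 * d).
suff E : m' = m by apply: slack_base_short => //; lia.
have [||i lt|H0 H1 H2] := @slack_base_short n m' d dd; try lia.
  by apply: ag; lia.
by have := cnt_sum m'; have := cnt_sum n; have := cnt_sum (n + d); lia.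
Qed.

Lemma cnt_leq x a i j : i <= j -> cnt x a i <= cnt x a j.
Proof. by move=> /subnKC <-; rewrite cntD leq_addr. Qed.

(** This is [slack] for the empty overlap with period 17. *)
Lemma cnt_window a i : cnt p a i < cnt p a (i + 17).
Proof.
have [//|//|j lt|] := @slack_base i i 17; first by lia.
by case: (trit_case a) => -> H0 H1 H2; lia.
Qed.

Lemma h_block k :
  [\/ [/\ p k = trit0, posh k.+1 = (posh k).+2, p (posh k) = trit0
        & p (posh k).+1 = trit1],
      [/\ p k = trit1, posh k.+1 = (posh k).+2, p (posh k) = trit2
        & p (posh k).+1 = trit1]
    | [/\ p k = trit2, posh k.+1 = (posh k).+1, p (posh k) = trit0
        & p (posh k).+1 <> trit1]].
Proof.
have E j : j < size (h (p k)) -> p (posh k + j) = nth trit0 (h (p k)) j.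
  exact: (nth_pos p_morph_h trit0).
have := E 0; have := E 1; rewrite addn0 addn1.
have := pos_first size_h p_morph_h trit0 k.+1; rewrite posS.
case: (trit_case (p k)) => -> /= E2 E1 E0.
- by apply: Or31; split; rewrite ?E0 ?E1 // addn2.
- by apply: Or32; split; rewrite ?E0 ?E1 // addn2.
- apply: Or33; rewrite addn1 in E2 *; split; rewrite ?E0 // E2.
  by case: (trit_case (p k.+1)) => ->.
Qed.

Lemma h_cut i : p i <> trit1 -> exists k, i = posh k.
Proof.
move=> ne; have [k /andP[le lt]] := pos_find p size_h i.
exists k; have [//|ne_ik] := eqVneq i (posh k).
have ei : i = (posh k).+1 -> p i = p (posh k).+1 by move=> ->.
case: (h_block k) => -[_ e _ e1]; last by lia.
all: by case: ne; rewrite ei //; lia.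
Qed.

(** Where the agreement of [p] with shift [e] stops on the left at two distinct
    letters, the images agree on the common suffix of two blocks; it is the
    letter 1 if the letters are 0 and 1, and empty otherwise.  In the first case
    the letters found before it are 0 and 2, so that the image is not left
    extendable in turn. *)
Lemma h_left_end d a c e n0 : agree p d a c -> posh n0 <= c ->
    posh (n0 + e) = posh n0 + d ->
    posh n0 <= a \/ (0 < n0 /\ p n0.-1 <> p (n0.-1 + e)) ->
  posh n0 <= a \/
    [/\ posh n0 = a.+1, p a = trit1, left_ext n0 e = true & left_ext a d = false].
Proof.
move=> ag n0c; case: n0 n0c => [|k] n0c sk [|[n0_gt0 ne]]; try by left.
have [|lta] := leqP (posh k.+1) a; [by left|right].
rewrite /= in ne.
have agk j : a <= j < posh k.+1 -> p j = p (j + d) by move=> ?; apply: ag; lia.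
have := h_block (k + e); rewrite -addSn sk => Bke.
have B21 : posh k.+1 = (posh k).+2 -> posh k.+1 + d = (posh (k + e)).+2 ->
    p (posh k) <> p (posh (k + e)) ->
    a = (posh k).+1 /\ posh (k + e) = posh k + d.
  move=> e1 e2 neq; have e3 : posh (k + e) = posh k + d by lia.
  split=> //; have [le|] := leqP a (posh k); last by lia.
  by case: neq; rewrite e3; apply: agk; lia.
have B0 j j' : a <= j < posh k.+1 -> j' = j + d -> p j <> p j' -> False.
  by move=> /agk ej ->.
rewrite /left_ext /=.
case: (h_block k) Bke => -[pk e1 k0 k1] [] [pke e2 ke0 ke1];
  move: ne; rewrite pk pke // => _.
- have [|||ea eb] := B21; rewrite ?k0 ?ke0 //.
  by rewrite ea /= -eb k0 ke0; split; rewrite ?andbF.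
- by case: (B0 (posh k).+1 (posh (k + e))); rewrite ?k1 ?ke0 //; lia.
- have [|||ea eb] := B21; rewrite ?k0 ?ke0 //.
  by rewrite ea /= -eb k0 ke0; split; rewrite ?andbF.
- by case: (B0 (posh k).+1 (posh (k + e))); rewrite ?k1 ?ke0 //; lia.
- by case: (B0 (posh k) (posh (k + e)).+1); rewrite ?k0 ?ke1 //; lia.
- by case: (B0 (posh k) (posh (k + e)).+1); rewrite ?k0 ?ke1 //; lia.
Qed.

(** Symmetrically, the images agree on the common prefix of two blocks, which is
    the letter 0 if the letters are 0 and 2, and empty otherwise.  After this
    common 0, the images continue with 1 and with a letter other than 1. *)
Lemma h_right_end d a c e m0 : agree p d a c -> a <= posh m0 ->
    posh (m0 + e) = posh m0 + d -> c <= posh m0 \/ p m0 <> p (m0 + e) ->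
  c <= posh m0 \/
    [/\ c = (posh m0).+1, p (posh m0) = trit0, right_ext m0 e = true
      & right_ext c d = false].
Proof.
move=> ag am sm [|ne]; first by left.
have [|ltm] := leqP c (posh m0); [by left|right].
have agm : p (posh m0) = p (posh (m0 + e)) by rewrite sm; apply: ag; lia.
have agm1 : (posh m0).+1 < c -> p (posh m0).+1 = p (posh (m0 + e)).+1.
  by move=> lt; rewrite sm; apply: ag; lia.
rewrite /right_ext.
case: (h_block m0) (h_block (m0 + e)) => -[pk e1 k0 k1] [] [pke e2 ke0 ke1];
  move: ne agm; rewrite pk pke k0 ke0 // => _ _.
- have ec : c = (posh m0).+1.
    by have [lt|] := ltnP (posh m0).+1 c; [case: ke1; rewrite -agm1|lia].
  by rewrite ec addSn -sm k1; split.
- have ec : c = (posh m0).+1.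
    by have [lt|] := ltnP (posh m0).+1 c; [case: k1; rewrite agm1|lia].
  rewrite ec addSn -sm ke1; split=> //.
  by case: (trit_case (p (posh m0).+1)) => ->.
Qed.

(** An agreement with shift [d >= 35] that contains a cutting point is decoded to
    an agreement with shift [e], where [17 <= e < d] since blocks have length 1
    or 2, and not all of them have length 1.  For a period [v] with overlap [x],
    let [D a] be the difference [3 * count_mem a v - 2 * count_mem a x].  Under
    [h], the values [D 0], [D 1] and [D 2] become [D 0 + D 2], [D 0 + D 1] and
    [D 1]; an extension on the left then lowers the second one by 2, and an
    extension on the right the first one.  This preserves the bounds of [slack]. *)
Lemma slack_p n m d : 17 <= d -> n <= m -> agree p d n m -> slack n m d.
Proof.
elim/ltn_ind: d n m => d IH a c d17 ac ag.
have [d35|d35] := leqP d 34; first by apply: slack_base => //; lia.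
have window u i : cnt p u i + 2 <= cnt p u (i + d).
  have := cnt_window u i; have := cnt_window u (i + 17).
  have : cnt p u (i + 17 + 17) <= cnt p u (i + d) by apply: cnt_leq; lia.
  by lia.
(* the first cutting point from [a] on *)
have [n [an cn]] : exists n, a <= posh n /\
    (posh n <= a \/ posh n = a.+1 /\ p a = trit1).
  have [e|ne] := eqVneq (p a) trit1; last first.
    by have [n ->] := h_cut (elimN eqP ne); exists n; split; [|left].
  have [|n en] := @h_cut a.+1.
    by have := p_adj a; rewrite e; case: (trit_case (p a.+1)) => ->.
  by exists n; rewrite -en; split; [lia|right].
(* without a cutting point, the overlap is empty or the single letter 1 *)
have [cle|ltc] := leqP c (posh n).
  have := window trit0 a; have := window trit1 a; have := window trit2 a.
  have [->|[ec pa]] : c = a \/ c = a.+1 /\ p a = trit1.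
  - case: cn => [le|[en pa]]; first by left; lia.
    by have [->|] := eqVneq c a; [left|right; split=> //; lia].
  - by move=> W2 W1 W0; split; lia.
  - by rewrite ec; move=> W2 W1 W0; split; rewrite cntS pa /=; lia.
have n_cut : p (posh n) <> trit1.
  by case: (h_block n) => -[_ _ -> _].
have [n' En'] : exists n', posh n + d = posh n'.
  by apply: h_cut; rewrite -ag //; lia.
have nn' : n < n'.
  by rewrite ltnNge; apply/negP => /(pos_leq p size_h); lia.
pose e := n' - n; have En : posh (n + e) = posh n + d by rewrite subnKC // ltnW.
have [n0 [m0 [/andP[n0n nm0] ag' shift left right]]] :=
  desubst_agree size_h a c En.
have V u : cnt p u (n + e) + cnt p u n0 = cnt p u (n0 + e) + cnt p u n.
  exact: agree_cnt ag' (leqnn _) n0n nm0.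
have W u : cnt p u (posh n + d) + cnt p u a = cnt p u (a + d) + cnt p u (posh n).
  exact: agree_cnt ag (leqnn _) an (ltnW ltc).
have len : d + 2 * cnt p trit0 n + 2 * cnt p trit1 n + cnt p trit2 n =
    2 * cnt p trit0 (n + e) + 2 * cnt p trit1 (n + e) + cnt p trit2 (n + e).
  by move: En; rewrite !(pos_cnt h) /=; lia.
have := cnt_sum n; have := cnt_sum (n + e) => sum_ne sum_n.
have e17 : 17 <= e by have := cnt_leq p trit2 (leq_addr e n); lia.
have lt_ed : e < d.
  have := cnt_window trit0 n; have := cnt_leq p trit1 (leq_addr e n).
  by have := @cnt_leq p trit0 (n + 17) (n + e); lia.
have le_n0 : posh n0 <= c.
  by apply: leq_trans (ltnW ltc); apply: (pos_leq p size_h).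
have le_m0 : a <= posh m0 by apply: leq_trans an _; apply: (pos_leq p size_h).
have Sn0 : posh (n0 + e) = posh n0 + d by apply: shift; lia.
have Sm0 : posh (m0 + e) = posh m0 + d by apply: shift; lia.
have HL := h_left_end ag le_n0 Sn0 left.
have HR := h_right_end ag le_m0 Sm0 right.
have [S0 S1 S2] := IH e lt_ed n0 m0 e17 (leq_trans n0n nm0) ag'.
have [l [l_le l_add L0 L1 L2]] : exists l, [/\ l <= left_ext n0 e, l + left_ext a d <= 1,
    cnt p trit0 (posh n0) <= cnt p trit0 a, cnt p trit1 (posh n0) <= cnt p trit1 a + l
    & cnt p trit2 (posh n0) <= cnt p trit2 a].
  case: HL => [le|[-> pa -> ->]]; [exists 0|exists 1].
    by rewrite add0n addn0 leq_b1 !cnt_leq.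
  by rewrite !cntS pa !addn0 !leqnn.
have [r [r_le r_add R0 R1 R2]] : exists r, [/\ r <= right_ext m0 e, r + right_ext c d <= 1,
    cnt p trit0 c <= cnt p trit0 (posh m0) + r, cnt p trit1 c <= cnt p trit1 (posh m0)
    & cnt p trit2 c <= cnt p trit2 (posh m0)].
  case: HR => [le|[-> pc -> ->]]; [exists 0|exists 1].
    by rewrite add0n addn0 leq_b1 !cnt_leq.
  by rewrite !cntS pc !addn0 !leqnn.
have := W trit0; have := W trit1; have := W trit2.
have := V trit0; have := V trit1; have := V trit2.
rewrite -En !cnt0_posh !cnt1_posh !cnt2_posh in L0 L1 L2 R0 R1 R2 *.
move=> V2 V1 V0 W2 W1 W0; rewrite /slack; move: l_add r_add l_le r_le S0 S1.
move: (nat_of_bool (left_ext a d)) (nat_of_bool (right_ext c d)) => la rc.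
move: (nat_of_bool (left_ext n0 e)) (nat_of_bool (right_ext m0 e)) => ln rm.
by move=> *; split; lia.
Qed.

(** * Overlaps of [q] *)

Definition gh (k : nat) (u : seq 'I_3) : seq 'I_2 := morph g (iter k (morph h) u).

Lemma gh_cat k u v : gh k (u ++ v) = gh k u ++ gh k v.
Proof. by rewrite /gh iter_h_cat morph_cat. Qed.

Lemma gh_p k n : gh k (mkseq p n) = mkseq q (size (gh k (mkseq p n))).
Proof. by rewrite /gh iter_h_p; apply: qP. Qed.

(** A factor with period [d] and exponent greater than 5/2 contains two agreeing
    words of length more than [3 * d / 2] at distance [d]. *)
Definition low_power (c : nat) (w : seq 'I_2) : bool :=
  all (fun d => take (3 * d)./2.+1 w != take (3 * d)./2.+1 (drop d w)) (iota 1 c).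

(** The longest word read by [low_power 48] has length [73 + 48 = 121]. *)
Lemma size_gh8 a : 121 <= size (gh 8 [:: a]).
Proof. by case: (trit_case a) => ->; vm_compute. Qed.

Lemma low_power_q i : low_power 48 (fac q i 121).
Proof.
apply: (all_windows (gh_cat 8) (gh_p 8) size_gh8 isT).
by vm_compute.
Qed.

Lemma q_agree_short d a c : 0 < d <= 48 -> agree q d a c -> 2 * (c - a) <= 3 * d.
Proof.
move=> dd ag; rewrite leqNgt; apply/negP => lt.
have := allP (low_power_q a) d; rewrite mem_iota drop_fac ?take_fac; try lia.
move=> /(_ _)/negP[]; first by lia.
by apply/eqP/eq_fac => k lk; rewrite addnAC; apply: ag; lia.
Qed.

Lemma g_block k :
  [\/ [/\ p k = trit0, posg k.+1 = (posg k).+3, q (posg k) = bit0,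
          q (posg k).+1 = bit1 & q (posg k).+2 = bit1],
      [/\ p k = trit1, posg k.+1 = (posg k).+1, q (posg k) = bit0
        & q (posg k).+1 = bit0]
    | [/\ p k = trit2, posg k.+1 = (posg k).+2, q (posg k) = bit0,
          q (posg k).+1 = bit1 & q (posg k).+2 = bit0]].
Proof.
have E j : j < size (g (p k)) -> q (posg k + j) = nth bit0 (g (p k)) j.
  exact: (nth_pos qP bit0).
have := E 0; have := E 1; have := E 2; rewrite addn0 addn1 addn2.
have E2 : q (posg k.+1) = bit0.
  by rewrite (pos_first size_g qP bit0); case: (trit_case (p k.+1)) => ->.
rewrite posS in E2; rewrite posS; clear E.
case: (trit_case (p k)) E2 => -> /= E3 E2 E1 E0.
- by apply: Or31; rewrite E0 ?E1 ?E2 // addn3.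
- by apply: Or32; rewrite addn1 in E3 *; rewrite E0.
- by apply: Or33; rewrite addn2 in E3 *; rewrite E0 ?E1.
Qed.

Lemma g_cut i : q i = bit0 -> exists k, i = posg k.
Proof.
move=> qi; have [k /andP[le lt]] := pos_find p size_g i.
exists k; have [//|ne] := eqVneq i (posg k).
case: (g_block k) => [[_ e _ e1 e2]|[_ e _ _]|[_ e _ e1 _]]; last 1 first.
- by have E : i = (posg k).+1 by [lia]; move: qi; rewrite E e1.
- have [E|E] : i = (posg k).+1 \/ i = (posg k).+2 by lia.
    by move: qi; rewrite E e1.
  by move: qi; rewrite E e2.
- by lia.
Qed.

(** Blocks of [g] have length at most 3, so that a shift larger than 48 decodes to a
    shift of at least 17 in [p].  At the ends, distinct blocks of [g] share a
    suffix of at most one letter and, followed by the next block, a prefix of at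
    most two letters.  As [g] has blocks of lengths 3, 1 and 2, the margins of
    [slack_p] add up to [3 + 1 + 2 = 6], which is twice these three letters. *)
Lemma q_agree_bound d a c : 0 < d -> agree q d a c -> 2 * (c - a) <= 3 * d.
Proof.
move=> d0 ag; have [d48|d49] := leqP d 48; first by apply: q_agree_short ag; lia.
have [ca|ac] := leqP (c - a) 2; first by lia.
have [n [an cn]] : exists n, a <= posg n /\ posg n <= a.+2.
  have [k /andP[ka ak]] := pos_find p size_g a; have [ek|ne] := eqVneq a (posg k).
    by exists k; lia.
  by exists k.+1; case: (g_block k) => -[_ e _ _]; lia.
have n_cut k : q (posg k) = bit0 by case: (g_block k) => -[].
have [n' En'] : exists n', posg n + d = posg n'.
  by apply: g_cut; rewrite -ag ?n_cut //; lia.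
have nn' : n < n'.
  by rewrite ltnNge; apply/negP => /(pos_leq p size_g); lia.
pose e := n' - n; have En : posg (n + e) = posg n + d by rewrite subnKC // ltnW.
have [n0 [m0 [/andP[n0n nm0] ag' shift left right]]] :=
  desubst_agree size_g a c En.
have e17 : 17 <= e.
  have lp u := cnt_leq p u (leq_addr e n).
  have := lp trit0; have := lp trit1; have := lp trit2.
  have := cnt_sum n; have := cnt_sum (n + e).
  by move: En; rewrite !(pos_cnt g) /=; lia.
have HL : posg n0 <= a.+1.
  case: left => [|[n0_gt0 ne]]; first by move/leqW.
  rewrite leqNgt; apply/negP => lta.
  case: n0 n0_gt0 ne n0n ag' shift lta => // k _ /= ne kn _ shift lta.
  have le_kn : posg k.+1 <= posg n by apply: (pos_leq p size_g).
  have sk : posg (k.+1 + e) = posg k.+1 + d by apply: shift; lia.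
  have agk j j' : a <= j < posg k.+1 -> j' = j + d -> q j <> q j' -> False.
    by move=> aj -> []; apply: ag; lia.
  have := g_block (k + e); rewrite -addSn sk; move: ne.
  case: (g_block k) => [[-> e1 k0 k1 k2]|[-> e1 k0 k1]|[-> e1 k0 k1 _]] ne.
  - case=> [[pke]|[_ e2 l0 _]|[_ e2 l0 l1 _]]; first by rewrite pke in ne.
    + by apply: (agk (posg k).+2 (posg (k + e))); rewrite ?k2 ?l0 //; lia.
    + by apply: (agk (posg k).+1 (posg (k + e))); rewrite ?k1 ?l0 //; lia.
  - case=> [[_ e2 _ _ l2]|[pke]|[_ e2 l0 l1 _]]; last 2 first.
    + by rewrite pke in ne.
    + by apply: (agk (posg k) (posg (k + e)).+1); rewrite ?k0 ?l1 //; lia.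
    + by apply: (agk (posg k) (posg (k + e)).+2); rewrite ?k0 ?l2 //; lia.
  - case=> [[_ e2 l0 l1 l2]|[_ e2 l0 _]|[pke]]; last by rewrite pke in ne.
    + by apply: (agk (posg k) (posg (k + e)).+1); rewrite ?k0 ?l1 //; lia.
    + by apply: (agk (posg k).+1 (posg (k + e))); rewrite ?k1 ?l0 //; lia.
have HR : c <= (posg m0).+2.
  case: right => [le|ne]; first by rewrite !(leqW, ltnS).
  rewrite leqNgt; apply/negP => ltm.
  have le_nm : posg n <= posg m0 by apply: (pos_leq p size_g).
  have sm : posg (m0 + e) = posg m0 + d by apply: shift; lia.
  have a1 : q (posg m0).+1 = q (posg (m0 + e)).+1 by rewrite sm; apply: ag; lia.
  have a2 : q (posg m0).+2 = q (posg (m0 + e)).+2 by rewrite sm; apply: ag; lia.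
  move: ne a1 a2.
  case: (g_block m0) => [[-> _ _ -> ->]|[-> _ _ ->]|[-> _ _ -> ->]];
    by case: (g_block (m0 + e)) => [[-> _ _ -> ->]|[-> _ _ ->]|[-> _ _ -> ->]].
have [S0 S1 S2] := slack_p e17 (leq_trans n0n nm0) ag'.
have Sn0 : posg (n0 + e) = posg n0 + d by apply: shift; lia.
by move: Sn0 HL HR; rewrite !(pos_cnt g) /=; lia.
Qed.

(** * Strong bispecial factors of [p] *)

(** The four two-sided extensions of [w] by two letters on each side all occur. *)
Definition strong_bispecial (A : finType) (x : nat -> A) (w : seq A) : Prop :=
  exists a b c d, [/\ a <> b, c <> d &
    forall l r, l \in [:: a; b] -> r \in [:: c; d] ->
      is_factor (l :: rcons w r) x].

Section Occurrences.
Variables (A : finType) (x : nat -> A).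
Implicit Types (l r : A) (w : seq A).

Lemma factor_ext l w r : is_factor (l :: rcons w r) x ->
  exists i, [/\ x i = l, fac x i.+1 (size w) = w & x (i.+1 + size w) = r].
Proof.
case=> i; rewrite -/(fac x i _) /= size_rcons facS fac_rcons => -[-> /rcons_inj[E ->]].
by exists i; split.
Qed.

Lemma ext_factor i n : is_factor (x i :: rcons (fac x i.+1 n) (x (i.+1 + n))) x.
Proof. by rewrite -fac_rcons -facS; apply: factor_fac. Qed.

(** An occurrence of [s ++ v] in which [v] starts at a letter of the kind [c] that
    marks the cutting points. *)
Lemma factor_ext_cut (cut : nat -> nat) (c : A -> Prop) (a0 : A) s v l r :
    (forall i, c (x i) -> exists k, i = cut k) -> c (head a0 v) -> v != [::] ->
    is_factor (l :: rcons (s ++ v) r) x ->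
  exists k, [/\ fac x (cut k) (size v) = v, x (cut k + size v) = r,
    s = fac x (cut k - size s) (size s), size s < cut k
    & l = x (cut k - (size s).+1)].
Proof.
move=> cutP hv v0 /factor_ext[i [il iw ir]]; move: iw ir; rewrite size_cat facD => /eqP.
rewrite eqseq_cat ?size_fac // => /andP[/eqP es /eqP ev] ir.
have [|k ek] := cutP (i.+1 + size s).
  by case: v v0 hv ev {ir} => // b v _ /= cb; rewrite facS => -[->].
exists k; rewrite -ek; split=> //.
- by rewrite -addnA.
- by rewrite addnK es.
- by rewrite addSn ltnS leq_addl.
- by rewrite addSnnS addnK.
Qed.

Lemma strong_bispecial_map (B : finType) (y : nat -> B) (u : seq B)
    (f f' : A -> B) :
  (exists a b c d, [/\ a <> b, c <> d, f a <> f b, f' c <> f' d &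
    forall l r, l \in [:: a; b] -> r \in [:: c; d] ->
      is_factor (f l :: rcons u (f' r)) y]) -> strong_bispecial y u.
Proof.
case=> a [b [c [d [ab cd fab fcd H]]]]; exists (f a), (f b), (f' c), (f' d).
split=> // l r; rewrite !inE => /orP[]/eqP-> /orP[]/eqP->; apply: H;
  by rewrite !inE eqxx ?orbT.
Qed.

End Occurrences.

(** The preimage of a word that starts with a block, with the undecoded rest: a last
    letter 0 may be the block of 2 or the beginning of the block of 0, and a last
    letter 2 is the beginning of a block. *)
Fixpoint decode_h (w : seq 'I_3) : seq 'I_3 * seq 'I_3 :=
  match w with
  | a :: ((b :: s) as s') =>
    if val b == 1 then
      ((if val a == 0 then trit0 else trit1) :: (decode_h s).1, (decode_h s).2)
    else (trit2 :: (decode_h s').1, (decode_h s').2)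
  | _ => ([::], w)
  end.

Lemma decode_hE a b s : decode_h (a :: b :: s) =
  if val b == 1 then
    ((if val a == 0 then trit0 else trit1) :: (decode_h s).1, (decode_h s).2)
  else (trit2 :: (decode_h (b :: s)).1, (decode_h (b :: s)).2).
Proof. by []. Qed.

Lemma size_decode_h w : w != [::] -> size (decode_h w).1 < size w.
Proof.
elim: {w}(size w) {-2}w (leqnn (size w)) => [|n IH] [|a [|b s]] // le _.
rewrite decode_hE; case: ifP => _; last exact: (IH (b :: s) le isT).
case: s le => [|c s] // le.
by have := IH (c :: s) (ltnW le) isT => lt; apply: leqW.
Qed.

Lemma decode_hP n k (ut := decode_h (fac p (posh k) n)) :
  [/\ fac p k (size ut.1) = ut.1,
      fac p (posh (k + size ut.1)) (size ut.2) = ut.2,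
      posh (k + size ut.1) + size ut.2 = posh k + n & size ut.2 <= 1].
Proof.
rewrite {}/ut; elim/ltn_ind: n k => -[|[|n]] IH k.
- by split; rewrite /= ?addn0.
- by split; rewrite /= ?addn0 ?facS.
rewrite facS (facS _ _.+1) decode_hE.
case: (h_block k) => -[pk e1 k0 k1].
- have := IH n _ k.+1; rewrite k0 k1 e1 => -[] // H1 H2 H3 H4.
  by split=> //=; [rewrite facS pk H1|rewrite -addSnnS|rewrite -addSnnS H3 !addSnnS].
- have := IH n _ k.+1; rewrite k0 k1 e1 => -[] // H1 H2 H3 H4.
  by split=> //=; [rewrite facS pk H1|rewrite -addSnnS|rewrite -addSnnS H3 !addSnnS].
- have -> : (val (p (posh k).+1) == 1) = false.
    by apply/eqP => E; apply: k1; apply: val_inj.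
  have := IH n.+1 _ k.+1; rewrite e1 facS => -[] // H1 H2 H3 H4.
  by split=> //=; [rewrite facS pk H1|rewrite -addSnnS|rewrite -addSnnS H3 !addSnnS].
Qed.

Lemma p_not212 i : p i = trit2 -> p i.+2 = trit2 -> False.
Proof.
move=> pi pi2; have [k ei] := @h_cut i ltac:(by rewrite pi).
case: (h_block k) => -[pk e1 k0 k1]; rewrite -ei in e1 k0 k1.
- by rewrite k0 in pi.
- rewrite -e1 in pi2; have := p_adj k; rewrite pk.
  by case: (h_block k.+1) => -[-> _ E _] //; rewrite E in pi2.
- by rewrite k0 in pi.
Qed.

Lemma adj_ext l w r : is_factor (l :: rcons w r) p ->
  adj l (head r w) /\ adj (last l w) r.
Proof.
case/factor_ext=> i [<- <- <-]; rewrite size_fac; move: (size w) => n; split.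
  by case: n => [|n]; [rewrite addn0|rewrite facS]; apply: p_adj.
case: n => [|n]; first by rewrite addn0; apply: p_adj.
by rewrite fac_rcons last_rcons addnS; apply: p_adj.
Qed.

(** What the letter [l] that precedes a factor [s ++ v] tells about the letter [l']
    that precedes the preimage of [v], where [s] is empty or consists of the letter 1. *)
Definition left_h (s : seq 'I_3) (l l' : 'I_3) : Prop :=
  if s is [::] then [/\ l <> trit2, l = trit0 -> l' = trit2 & l <> trit0 -> l' <> trit2]
  else [/\ l <> trit1, l = trit0 -> l' = trit0 & l = trit2 -> l' = trit1].

Lemma left_hP s k : head trit1 s = trit1 -> size s <= 1 -> 0 < k ->
  s = fac p (posh k - size s) (size s) -> left_h s (p (posh k - (size s).+1)) (p k.-1).
Proof.
case: k => // k; case: s => [|x [|? ?]] //= hs _ _ es.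
  by rewrite subn1; case: (h_block k) => -[-> -> k0 k1] /=; rewrite ?k0 ?k1.
have e1 : x = p (posh k.+1 - 1) by move: es; rewrite facS => /(congr1 (head x)).
move: e1; rewrite hs subn1 subn2 => e1 {es}.
by case: (h_block k) e1 => -[-> -> k0 k1] /=; rewrite ?k0 ?k1.
Qed.

(** What the letter [r] that follows a factor with undecoded rest [t] tells about
    the letter [r'] that follows its preimage. *)
Definition right_h (t : seq 'I_3) (r r' : 'I_3) : Prop :=
  if t is x :: _ then
    [/\ r <> trit0, x <> trit1, x = trit2 -> r = trit1,
        r = trit1 -> x = trit0 -> r' = trit0 & r = trit2 -> r' = trit2]
  else [/\ r <> trit1, r = trit2 -> r' = trit1 & r <> trit2 -> r' <> trit1].

Lemma right_hP t m : size t <= 1 -> fac p (posh m) (size t) = t ->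
  right_h t (p (posh m + size t)) (p m).
Proof.
case: t => [|x [|? ?]] //= _.
  by rewrite addn0; case: (h_block m) => -[-> _ -> _].
rewrite facS addn1 => -[<-].
have := p_adj (posh m).
by case: (h_block m) => -[-> _ -> m1]; move: m1;
  case: (trit_case (p (posh m).+1)) => ->.
Qed.

(** The four extensions of [w] decode to four extensions of the preimage [u] of [w].
    On the left, the letter [l'] is determined by [l] except when [w] starts with
    a block and [l] is 1: then it is 0 or 1.  But in a strong bispecial factor the
    extension by [l = 0] occurs too; it comes from the letter 2, so that [u]
    starts with 1 and cannot be preceded by 1.  The ambiguity on the right, when
    [w] ends with a complete block, is resolved in the same way.  Hence [u] is
    strong bispecial and shorter. *)
Lemma no_strong_bispecial_p w : ~ strong_bispecial p w.
Proof.
elim: {w}(size w).+1 {-2}w (leqnn (size w).+1) => // N IH w; rewrite ltnS => wN.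
case=> a [b [c [d [ab cd H]]]].
have La : a \in [:: a; b] by rewrite !inE eqxx.
have Lb : b \in [:: a; b] by rewrite !inE eqxx orbT.
have Rc : c \in [:: c; d] by rewrite !inE eqxx.
have Rd : d \in [:: c; d] by rewrite !inE eqxx orbT.
have ADJ l r lL rR := adj_ext (H l r lL rR).
have [|w1] := leqP (size w) 1.
  move: (ADJ _ _ La Rc) (ADJ _ _ La Rd) (ADJ _ _ Lb Rc) (ADJ _ _ Lb Rd).
  case: w {wN ADJ} H => [|x [|? ?]] //= H A1 A2 A3 A4 _; move: ab cd.
    move: A1 A2 A3 A4 {H La Lb Rc Rd}.
    by case: (trit_case a) => ->; case: (trit_case b) => ->;
      case: (trit_case c) => ->; case: (trit_case d) => -> [? _] [? _] [? _] [? _].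
  (* for [w = 1], the pairs of consecutive letters alone do not exclude 212 *)
  have no212 : trit2 \in [:: a; b] -> trit2 \in [:: c; d] -> x = trit1 -> False.
    move=> h2 h2' _; have [i [pi _ pi2]] :=
      @factor_ext _ _ trit2 [:: x] trit2 (H _ _ h2 h2').
    by apply: (p_not212 pi); rewrite -pi2 addn1.
  move: A1 A2 A3 A4 no212 {H La Lb Rc Rd}.
  by case: (trit_case x) => ->; case: (trit_case a) => ->; case: (trit_case b) => ->;
    case: (trit_case c) => ->; case: (trit_case d) => -> [? ?] [? ?] [? ?] [? ?] no;
    move=> // _ _; apply: no.
(* [s] is the end of an incomplete first block *)
have [s [v [ew v0 hv hs s1]]] : exists s v, [/\ w = s ++ v, v != [::],
    head trit1 v <> trit1, head trit1 s = trit1 & size s <= 1].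
  case: w w1 ADJ H {IH wN} => [|x [|y w]] // _ ADJ H.
  have [ex|nx] := eqVneq x trit1; last first.
    by exists [::], [:: x, y & w]; split=> //; apply/eqP.
  exists [:: x], (y :: w); split=> //.
  have [i [_ ]] := factor_ext (H a c La Rc); rewrite /= !facS => -[e1 e2 _] _.
  by move: (p_adj i.+1); rewrite e1 e2 ex; case: (trit_case y) => ->.
have [u [t [uw u0 D]]] : exists u t, [/\ size u < size w,
    s = [::] \/ t = [::] -> u != [::]
    & forall l r, l \in [:: a; b] -> r \in [:: c; d] -> exists l' r',
      [/\ is_factor (l' :: rcons u r') p, left_h s l l' & right_h t r r']].
  have H' l r (lL : l \in [:: a; b]) (rR : r \in [:: c; d]) :=
    factor_ext_cut (c := fun a => a <> trit1) h_cut hv v0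
      (eq_ind w (fun w => is_factor (l :: rcons w r) p) (H l r lL rR) _ ew).
  exists (decode_h v).1, (decode_h v).2; split.
  - by apply: leq_trans (size_decode_h v0) _; rewrite ew size_cat leq_addl.
  - have [k [ev _ _ _ _]] := H' a c La Rc.
    have [_ _ H3 H4] := decode_hP (size v) k; rewrite ev in H3 H4.
    move=> st; apply/eqP => u0; move: H3; rewrite u0 addn0 => /addnI H3.
    case: st => st; last by move: v0; rewrite -size_eq0 -H3 st.
    by move: w1; rewrite ew st -H3 ltnNge H4.
  - move=> l r lL rR; have [k [ev vr es sk ->]] := H' l r lL rR.
    have [H1 H2 H3 H4] := decode_hP (size v) k; rewrite ev in H1 H2 H3 H4.
    have k0 : 0 < k by case: (k) sk.
    exists (p k.-1), (p (k + size (decode_h v).1)); split.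
    + by have := ext_factor p k.-1 (size (decode_h v).1); rewrite prednK // H1.
    + exact: left_hP.
    + by rewrite -vr -H3; apply: right_hP.
have {ADJ} ADJ l r lL rR := adj_ext (H l r lL rR).
have L0 : s = [::] -> trit0 \in [:: a; b].
  have [? [? [_ + _]]] := D a c La Rc; have [? [? [_ + _]]] := D b c Lb Rc.
  move=> + + es; rewrite es !inE /= => -[+ _ _] [+ _ _]; move: ab.
  by case: (trit_case a) => ->; case: (trit_case b) => ->.
have R0 : t = [::] -> trit0 \in [:: c; d].
  have [? [? [_ _ +]]] := D a c La Rc; have [? [? [_ _ +]]] := D a d La Rd.
  move=> + + et; rewrite et !inE /= => -[+ _ _] [+ _ _]; move: cd.
  by case: (trit_case c) => ->; case: (trit_case d) => ->.
have R2 : t = [::] -> trit2 \in [:: c; d].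
  have [? [? [_ _ +]]] := D a c La Rc; have [? [? [_ _ +]]] := D a d La Rd.
  move=> + + et; rewrite et !inE /= => -[+ _ _] [+ _ _]; move: cd.
  by case: (trit_case c) => ->; case: (trit_case d) => ->.
have hu : s = [::] -> head trit1 u = trit1.
  move=> es; have [l' [r' [/adj_ext[A _] + _]]] := D _ _ (L0 es) Rc.
  rewrite es => -[_ /(_ erefl) el' _]; move: A (u0 (or_introl es)); rewrite el'.
  by case: (u) => [|x ?] //=; case: (trit_case x) => ->.
have lu : t = [::] -> last trit0 u = trit0.
  move=> et; have [l' [r' [/adj_ext[_ A] _]]] := D _ _ La (R0 et).
  have [l2 [r2 [/adj_ext[_ A2] _]]] := D _ _ La (R2 et).
  rewrite et => -[_ /(_ erefl) el2 _] [_ _ er']; move: er' A A2.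
  rewrite el2; have := u0 (or_intror et); case: (u) => [|x u'] //= _ er'.
  have {er'} : r' <> trit1 by apply: er'.
  by case: (trit_case r') => ->; case: (trit_case (last x u')) => ->.
pose f l := if s is [::] then if l == trit0 then trit2 else trit0
  else if l == trit0 then trit0 else trit1.
pose f' r := if t is [::] then if r == trit2 then trit1 else trit2
  else if r == trit1 then trit0 else trit2.
apply: (IH u); first exact: leq_trans uw wN.
apply: (@strong_bispecial_map _ _ p u f f'); exists a, b, c, d.
have fD l r : l \in [:: a; b] -> r \in [:: c; d] ->
    is_factor (f l :: rcons u (f' r)) p.
  move=> lL rR; have [l' [r' [F Fl Fr]]] := D l r lL rR.
  have [A1 A2] := adj_ext F.
  suff [<- <-] : l' = f l /\ r' = f' r by [].
  split.
    case es: s => [|x s'].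
      have uh := hu es; have := u0 (or_introl es).
      move: Fl A1 uh; rewrite /f es /=; case: (u) => [|x u'] //= [nl2 el nl] A1 ex _.
      rewrite ex in A1; case: (trit_case l) => ll; rewrite ll in el nl nl2 *.
      - exact: el.
      - have {}nl : l' <> trit2 by apply: nl.
        by move: A1 nl; case: (trit_case l') => -> // _ [].
      - by case: nl2.
    move: Fl; rewrite /f es => -[n1 e0 e2]; move: n1 e0 e2.
    by case: (trit_case l) => -> // _ e0 e2; [apply: e0|apply: e2].
  case et: t => [|x t'].
    have uh := lu et; have := u0 (or_intror et).
    move: Fr A2 uh; rewrite /f' et /=; case: (u) => [|x u'] //= [nr1 er nr] A2 ex _.
    rewrite ex in A2; case: (trit_case r) => rr; rewrite rr in er nr nr1 *.
    - have {}nr : r' <> trit1 by apply: nr.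
      by move: A2 nr; case: (trit_case r') => -> // _ [].
    - by case: nr1.
    - exact: er.
  have x0 : x = trit0.
    have [? [? [_ _]]] := D a c La Rc; have [? [? [_ _]]] := D a d La Rd.
    rewrite et => -[_ nx ed _ _] [_ _ ec _ _].
    case: (trit_case x) => ex //; case: cd; rewrite ?ec ?ed //.
  move: Fr; rewrite /f' et => -[n0 _ _ e1 e2]; move: n0 e1 e2.
  by case: (trit_case r) => -> // _ e1 e2; [apply: e1|apply: e2].
split=> //.
- have [? [? [_ + _]]] := D a c La Rc; have [? [? [_ + _]]] := D b c Lb Rc.
  move: ab; rewrite /f; case: (s) => [|? ?] ab [+ _ _] [+ _ _]; move: ab.
    by case: (trit_case a) => ->; case: (trit_case b) => ->.
  by case: (trit_case a) => ->; case: (trit_case b) => ->.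
- have [? [? [_ _ +]]] := D a c La Rc; have [? [? [_ _ +]]] := D a d La Rd.
  move: cd; rewrite /f'; case: (t) => [|? ?] cd.
    move=> [+ _ _] [+ _ _]; move: cd.
    by case: (trit_case c) => ->; case: (trit_case d) => ->.
  move=> [+ _ _ _ _] [+ _ _ _ _]; move: cd.
  by case: (trit_case c) => ->; case: (trit_case d) => ->.
Qed.

(** * Strong bispecial factors of [q] *)

(** A block is complete when the next letter is 0, or when it is 011; hence the
    undecoded rest is empty, 0 or 01. *)
Fixpoint decode_g (w : seq 'I_2) : seq 'I_3 * seq 'I_2 :=
  match w with
  | a :: ((b :: s) as s') =>
    if val b == 0 then (trit1 :: (decode_g s').1, (decode_g s').2)
    else if s is c :: s'' then
      if val c == 0 then (trit2 :: (decode_g s).1, (decode_g s).2)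
      else (trit0 :: (decode_g s'').1, (decode_g s'').2)
    else ([::], w)
  | _ => ([::], w)
  end.

Lemma decode_gE a b s : decode_g (a :: b :: s) =
  if val b == 0 then (trit1 :: (decode_g (b :: s)).1, (decode_g (b :: s)).2)
  else if s is c :: s'' then
    if val c == 0 then (trit2 :: (decode_g s).1, (decode_g s).2)
    else (trit0 :: (decode_g s'').1, (decode_g s'').2)
  else ([::], [:: a; b]).
Proof. by case: s. Qed.

Lemma decode_gP n k (ut := decode_g (fac q (posg k) n)) :
  [/\ fac p k (size ut.1) = ut.1,
      fac q (posg (k + size ut.1)) (size ut.2) = ut.2,
      posg (k + size ut.1) + size ut.2 = posg k + n &
      [\/ ut.2 = [::], ut.2 = [:: bit0] | ut.2 = [:: bit0; bit1]]].
Proof.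
rewrite {}/ut; elim/ltn_ind: n k => -[|[|n]] IH k.
- by split; rewrite /= ?addn0 //; apply: Or31.
- split; rewrite /= ?addn0 ?facS //; apply: Or32.
  by case: (g_block k) => -[_ _ ->].
rewrite facS (facS _ _.+1) decode_gE.
case: (g_block k) => [[pk e1 k0 k1 k2]|[pk e1 k0 k1]|[pk e1 k0 k1 k2]].
- rewrite k0 k1; case: n IH => [|n] IH.
    split; rewrite /= ?addn0 ?facS ?k0 ?k1 //.
    by apply: Or33.
  have lt : n < n.+3 by lia.
  rewrite facS k2; have := IH n lt k.+1; rewrite e1 => -[] // H1 H2 H3 H4.
  by split=> //=; [rewrite facS pk H1|rewrite -addSnnS|rewrite -addSnnS H3 !addSnnS].
- have := IH n.+1 _ k.+1; rewrite k0 e1 facS k1 => -[] // H1 H2 H3 H4.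
  by split=> //=; [rewrite facS pk H1|rewrite -addSnnS|rewrite -addSnnS H3 !addSnnS].
- rewrite k0 k1; case: n IH => [|n] IH.
    split; rewrite /= ?addn0 ?facS ?k0 ?k1 //.
    by apply: Or33.
  have := IH n.+1 _ k.+1; rewrite e1 facS k2 => -[] // H1 H2 H3 H4.
  by split=> //=; [rewrite facS pk H1|rewrite -addSnnS|rewrite -addSnnS H3 !addSnnS].
Qed.

(** The analogues of [left_h] and [right_h]; an empty rest means that the last
    decoded block is 011, which is always followed by 0. *)
Definition left_g (s : seq 'I_2) (l : 'I_2) (l' : 'I_3) : Prop :=
  if s is [::] then (l = bit0 -> l' = trit1) /\ (l = bit1 -> l' <> trit1)
  else (l = bit0 -> l' = trit2) /\ (l = bit1 -> l' = trit0).

Lemma left_gP s k : head bit1 s = bit1 -> size s <= 1 -> 0 < k ->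
  s = fac q (posg k - size s) (size s) -> left_g s (q (posg k - (size s).+1)) (p k.-1).
Proof.
case: k => // k; case: s => [|x [|? ?]] //= hs _ _ es.
  rewrite subn1.
  by case: (g_block k) => [[-> -> k0 k1 k2]|[-> -> k0 k1]|[-> -> k0 k1 k2]] /=;
    rewrite ?k0 ?k1 ?k2.
have e1 : x = q (posg k.+1 - 1) by move: es; rewrite facS => /(congr1 (head x)).
move: e1; rewrite hs subn1 subn2 => e1 {es}.
by case: (g_block k) e1 => [[-> -> k0 k1 k2]|[-> -> k0 k1]|[-> -> k0 k1 k2]] /=;
  rewrite ?k0 ?k1 ?k2.
Qed.

Definition right_g (t : seq 'I_2) (r : 'I_2) (r' : 'I_3) : Prop :=
  match t with
  | [::] => r = bit0
  | [:: _] => (r = bit0 -> r' = trit1) /\ (r = bit1 -> r' <> trit1)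
  | _ => (r = bit1 -> r' = trit0) /\ (r = bit0 -> r' = trit2)
  end.

Lemma right_gP t m :
    [\/ t = [::], t = [:: bit0] | t = [:: bit0; bit1]] ->
    fac q (posg m) (size t) = t ->
  right_g t (q (posg m + size t)) (p m).
Proof.
case=> -> /= ft.
- by rewrite addn0; case: (g_block m) => -[_ _ ->].
- by rewrite addn1; case: (g_block m) => [[-> _ _ ->]|[-> _ _ ->]|[-> _ _ ->]].
- move: ft; rewrite !facS addn2 => -[_ e1].
  by case: (g_block m) e1 => [[-> _ _ -> ->]|[-> _ _ ->]|[-> _ _ -> ->]].
Qed.

Definition q_words4 : seq (seq 'I_2) :=
  [:: [:: bit0; bit0; bit1; bit0]; [:: bit0; bit0; bit1; bit1];
      [:: bit0; bit1; bit0; bit0]; [:: bit0; bit1; bit1; bit0];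
      [:: bit1; bit0; bit0; bit1]; [:: bit1; bit0; bit1; bit0];
      [:: bit1; bit1; bit0; bit0]; [:: bit1; bit1; bit0; bit1]].

Lemma q_factors4 i : fac q i 4 \in q_words4.
Proof.
pose P w := w \in q_words4.
have gh3 a : 4 <= size (gh 3 [:: a]) by case: (trit_case a) => ->; vm_compute.
by apply: (@all_windows _ _ _ 4 P (gh_cat 3) (gh_p 3) gh3 isT); vm_compute.
Qed.

Lemma strong_bispecial_bits w l r : strong_bispecial q w -> is_factor (l :: rcons w r) q.
Proof.
case=> a [b [c [d [ab cd H]]]].
apply: H; rewrite !inE.
  case: (bit_case a) (bit_case b) (bit_case l) ab => -> [] -> [] -> // ab; by case: ab.
case: (bit_case c) (bit_case d) (bit_case r) cd => -> [] -> [] -> // cd; by case: cd.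
Qed.

Lemma q_factor4 w : size w = 4 -> is_factor w q -> w \in q_words4.
Proof. by move=> w4 [i ->]; rewrite w4; apply: q_factors4. Qed.

Lemma q_cubefree x : ~ is_factor [:: x; x; x] q.
Proof.
case=> i E; have := q_factors4 i; rewrite fac_rcons -[fac q i 3]E.
by case: (bit_case x) (bit_case (q (i + 3))) => -> [] ->.
Qed.

(** As for [p], the extensions of [w] decode to extensions of its preimage [u], and
    the cases in which one bit does not determine the extending letter of [u]
    are settled by the presence of the other bit.  So [u] would be a strong
    bispecial factor of [p].  Factors of length at most 2 are excluded by the
    list of factors of length 4. *)
Lemma no_strong_bispecial_q w : w != [::] -> ~ strong_bispecial q w.
Proof.
move=> w0 ws; have H l r : is_factor (l :: rcons w r) q by apply: strong_bispecial_bits.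
have [|w2] := leqP (size w) 2.
  case: w w0 H {ws} => [|x [|y [|? ?]]] //= _ H _; first exact: (@q_cubefree x).
  case: (bit_case x) (bit_case y) H => -> [] -> H.
  - by have := @q_factor4 [:: _; _; _; _] erefl (H bit0 bit0).
  - by have := @q_factor4 [:: _; _; _; _] erefl (H bit1 bit1).
  - by have := @q_factor4 [:: _; _; _; _] erefl (H bit0 bit1).
  - by have := @q_factor4 [:: _; _; _; _] erefl (H bit1 bit1).
have [s [v [ew v0 hv hs s1]]] : exists s v, [/\ w = s ++ v, v != [::],
    head bit1 v = bit0, head bit1 s = bit1 & size s <= 1].
  case: w w0 w2 H {ws} => [|x [|y w]] // _ _ H.
  case: (bit_case x) => ex; first by exists [::], [:: x, y & w].
  exists [:: x], (y :: w); split=> //.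
  case: (bit_case y) => // ey; case: (@q_cubefree bit1).
  apply: (@factor_catl _ _ _ (rcons w bit0)).
  by have := H bit1 bit0; rewrite ex ey.
have [u [t [u0 t0 D]]] : exists u t, [/\ s = [::] \/ t = [:: bit0] -> u != [::],
    [\/ t = [::], t = [:: bit0] | t = [:: bit0; bit1]]
    & forall l r, exists l' r',
      [/\ is_factor (l' :: rcons u r') p, left_g s l l' & right_g t r r']].
  have H' l r := factor_ext_cut (c := fun a => a = bit0) g_cut hv v0
    (eq_ind w (fun w => is_factor (l :: rcons w r) q) (H l r) _ ew).
  exists (decode_g v).1, (decode_g v).2; split.
  - have [k [ev _ _ _ _]] := H' bit0 bit0.
    have [_ _ H3 H4] := decode_gP (size v) k; rewrite ev in H3 H4.
    move=> st; apply/eqP => u0; move: H3; rewrite u0 addn0 => /addnI H3.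
    have t2 : size (decode_g v).2 <= 2 by case: H4 => ->.
    case: st => st; first by move: w2; rewrite ew st -H3 ltnNge t2.
    by move: w2; rewrite ew size_cat -H3 st addn1 ltnNge ltnS s1.
  - have [k [ev _ _ _ _]] := H' bit0 bit0.
    by have [_ _ _ H4] := decode_gP (size v) k; rewrite ev in H4.
  - move=> l r; have [k [ev vr es sk ->]] := H' l r.
    have [H1 H2 H3 H4] := decode_gP (size v) k; rewrite ev in H1 H2 H3 H4.
    have k0 : 0 < k by case: (k) sk.
    exists (p k.-1), (p (k + size (decode_g v).1)); split.
    + by have := ext_factor p k.-1 (size (decode_g v).1); rewrite prednK // H1.
    + exact: left_gP.
    + by rewrite -vr -H3; apply: right_gP.
have {}t0 : t = [:: bit0] \/ t = [:: bit0; bit1].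
  by have [? [? [_ _ +]]] := D bit1 bit1; case: t0 => ->; [|left|right].
pose f l := if s is [::] then if l == bit0 then trit1 else trit0
  else if l == bit0 then trit2 else trit0.
pose f' r := if t is [:: _] then if r == bit0 then trit1 else trit2
  else if r == bit1 then trit0 else trit2.
apply: (@no_strong_bispecial_p u); apply: (@strong_bispecial_map _ _ p u f f').
exists bit0, bit1, bit0, bit1; split=> //.
- by rewrite /f; case: (s).
- by rewrite /f'; case: t0 => ->.
move=> l r _ _; have [l' [r' [F Fl Fr]]] := D l r.
have [A1 A2] := adj_ext F.
suff [<- <-] : l' = f l /\ r' = f' r by [].
split.
  case es: s => [|x s']; last first.
    move: Fl; rewrite /f es => -[e0 e1].
    by case: (bit_case l) => el; rewrite el; [apply: e0|apply: e1].
  have := u0 (or_introl es); have [l2 [r2 [F2 Fl2 _]]] := D bit0 r.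
  have [A3 _] := adj_ext F2; move: Fl2; rewrite es => -[/(_ erefl) el2 _].
  rewrite el2 in A3; move: Fl A1 A3; rewrite /f es; case: (u) => //= y _ [e0 e1] A1 A3 _.
  case: (bit_case l) => el; rewrite el /=; first exact: e0.
  have := e1 el; move: A1 A3.
  by case: (trit_case l') => ->; case: (trit_case y) => -> // _ _ [].
case: t0 => et; last first.
  move: Fr; rewrite /f' et => -[e0 e1].
  by case: (bit_case r) => er; rewrite er; [apply: e1|apply: e0].
have := u0 (or_intror et); have [l2 [r2 [F2 _ Fr2]]] := D l bit0.
have [_ A3] := adj_ext F2; move: Fr2; rewrite et => -[/(_ erefl) er2 _].
rewrite er2 in A3; move: Fr A2 A3; rewrite /f' et; case: (u) => //= y u' [e0 e1] A2 A3 _.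
case: (bit_case r) => er; rewrite er /=; first exact: e0.
have := e1 er; move: A2 A3.
by case: (trit_case r') => ->; case: (trit_case (last y u')) => -> // _ _ [].
Qed.

(** * The complexity of [q] *)

Lemma factor_morph_h w : is_factor w p -> is_factor (morph h w) p.
Proof.
by case=> i; rewrite -/(fac p i _) => ->; rewrite (morph_fac size_h p_morph_h); apply: factor_fac.
Qed.

Lemma factor_morph_g w : is_factor w p -> is_factor (rcons (morph g w) bit0) q.
Proof.
case=> i; rewrite -/(fac p i _) => ->; rewrite (morph_fac size_g qP).
move: (size w) => n; have <- : q (posg (i + n)) = bit0.
  by case: (g_block (i + n)) => -[].
have le : posg i <= posg (i + n) by rewrite (pos_leq p size_g) ?leq_addr.
by rewrite -[X in rcons _ (q X)](subnKC le) -fac_rcons; apply: factor_fac.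
Qed.

Lemma factor_2next u : is_factor (rcons u trit2) p ->
  is_factor (rcons (rcons u trit2) trit1) p.
Proof.
case=> i; rewrite -/(fac p i _) => E.
have := p_adj (i + size u); rewrite -addnS.
have : p (i + size u) = trit2.
  by move: E; rewrite size_rcons fac_rcons => /rcons_inj[].
move=> ->; case: (trit_case (p (i + (size u).+1))) => e1; rewrite e1 // => _.
by rewrite {1}E size_rcons -e1 -fac_rcons; apply: factor_fac.
Qed.

Definition rspecial (A : finType) (x : nat -> A) (a b : A) (u : seq A) : Prop :=
  is_factor (rcons u a) x /\ is_factor (rcons u b) x.

(** The blocks of 1 and 2 start with distinct letters, 2 and 0. *)
Lemma rspecial_h12 u : rspecial p trit1 trit2 u -> rspecial p trit0 trit2 (morph h u).
Proof.
case=> /factor_morph_h F1 /factor_morph_h F2; move: F1 F2.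
rewrite -!cats1 !morph_cat !morph1 /= => F1 F2; split; rewrite -cats1 //.
by apply: (@factor_catl _ _ _ [:: trit1]); rewrite -catA.
Qed.

(** The blocks of 0 and 2 both start with 0; after it comes the letter 1 in the block
    of 0, and the letter 2 in the block of 1 that follows every 2. *)
Lemma rspecial_h02 u : rspecial p trit0 trit2 u ->
  rspecial p trit1 trit2 (rcons (morph h u) trit0).
Proof.
case=> /factor_morph_h F1 /factor_2next/factor_morph_h F2; move: F1 F2.
rewrite -!cats1 !morph_cat !morph1 -!catA /= => F1 F2.
split; rewrite -!cats1 -catA //.
by apply: (@factor_catl _ _ _ [:: trit1]); rewrite -catA.
Qed.

Lemma size_morph_h u : size u <= size (morph h u).
Proof.
elim: u => // a u IH; rewrite -[a :: u]cat1s morph_cat morph1 !size_cat.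
by apply: leq_add => //; apply: size_h.
Qed.

Lemma size_morph_g u : size u <= size (morph g u).
Proof.
elim: u => // a u IH; rewrite -[a :: u]cat1s morph_cat morph1 !size_cat.
by apply: leq_add => //; apply: size_g.
Qed.

Lemma rspecial_p n : exists u, n <= size u /\ rspecial p trit1 trit2 u.
Proof.
elim: n => [|n [u [nu ru]]].
  exists [:: trit0]; split=> //; split.
    by exists 0; apply: (congr1 (take 2) (esym p_prefix)).
  by exists 4; apply: (congr1 (drop 4) (esym p_prefix)).
exists (rcons (morph h (morph h u)) trit0); split.
  rewrite size_rcons ltnS (leq_trans nu) // (leq_trans (size_morph_h u)) //.
  exact: size_morph_h.
exact/rspecial_h02/rspecial_h12.
Qed.

Lemma rspecial_suffix (A : finType) (x : nat -> A) a b u v :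
  rspecial x a b (u ++ v) -> rspecial x a b v.
Proof. by rewrite /rspecial !rcons_cat => -[/factor_catr F1 /factor_catr F2]. Qed.

(** The two families of right special factors of [p] yield two families in [q]: the
    blocks of 1 and 2 part after 0, those of 0 and 2 after 01.  Suffixes of right
    special factors are right special, so every length occurs. *)
Lemma rspecial_q c n : exists2 w, size w = n.+1 &
  last bit0 w = c /\ rspecial q bit0 bit1 w.
Proof.
suff [w nw [lw rw]] : exists2 w, n < size w & last bit0 w = c /\ rspecial q bit0 bit1 w.
  exists (drop (size w - n.+1) w); first by rewrite size_drop subKn.
  split; last by apply: (@rspecial_suffix _ _ _ _ (take (size w - n.+1) w)); rewrite cat_take_drop.
  rewrite -lw -[in RHS](cat_take_drop (size w - n.+1) w) last_cat.
  have: size (drop (size w - n.+1) w) != 0 by rewrite size_drop subKn.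
  by case: (drop _ w).
have [u [nu ru]] := rspecial_p n.
case: (bit_case c) => ->.
  exists (rcons (morph g u) bit0).
    by rewrite size_rcons ltnS (leq_trans nu) ?size_morph_g.
  rewrite last_rcons; split=> //; case: ru => /factor_morph_g F1 /factor_morph_g F2.
  move: F1 F2; rewrite -!cats1 !morph_cat !morph1 -!catA => F1 F2.
  split; rewrite -!cats1 -catA; first exact: F1.
  by apply: (@factor_catl _ _ _ [:: bit0]); rewrite -!catA.
have [F1 F2] := rspecial_h12 ru; exists (morph g (morph h u) ++ [:: bit0; bit1]).
  rewrite size_cat addn2 ltnS ltnW // ltnS (leq_trans nu) //.
  by rewrite (leq_trans (size_morph_h u)) ?size_morph_g.
rewrite last_cat; split=> //; move: (factor_morph_g F1) (factor_morph_g F2).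
rewrite -!cats1 !morph_cat !morph1 -!catA => {}F1 {}F2.
split; rewrite -cats1 -catA; first exact: F2.
by apply: (@factor_catl _ _ _ [:: bit0]); rewrite -!catA.
Qed.

Section Counting.
Variable x : nat -> 'I_2.

Definition factors n : {set n.-tuple 'I_2} := [set w | `[< is_factor (tval w) x >]].
Definition extends (c : 'I_2) n : {set n.-tuple 'I_2} :=
  [set w | `[< is_factor (rcons (tval w) c) x >]].
Definition rspecials n : {set n.-tuple 'I_2} :=
  [set w | `[< rspecial x bit0 bit1 (tval w) >]].

Lemma factorsP n (w : n.-tuple 'I_2) : reflect (is_factor w x) (w \in factors n).
Proof. by rewrite finset.in_set; apply: asboolP. Qed.

Lemma extendsP c n (w : n.-tuple 'I_2) :
  reflect (is_factor (rcons w c) x) (w \in extends c n).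
Proof. by rewrite finset.in_set; apply: asboolP. Qed.

Lemma rspecialsP n (w : n.-tuple 'I_2) :
  reflect (rspecial x bit0 bit1 w) (w \in rspecials n).
Proof. by rewrite finset.in_set; apply: asboolP. Qed.

Lemma complexityE n : complexity x n = #|factors n|.
Proof. by rewrite cardsE. Qed.

(** A factor has one or two extensions on the right, and two when it is right
    special. *)
Lemma complexityS n : complexity x n.+1 = complexity x n + #|rspecials n|.
Proof.
rewrite !complexityE.
have -> : factors n = extends bit0 n :|: extends bit1 n.
  apply/setP => w; rewrite finset.in_setU; apply/factorsP/orP => [[i E]|].
    have F : is_factor (rcons w (x (i + n))) x.
      by rewrite E -/(fac x i _) size_tuple -fac_rcons; apply: factor_fac.
    by case: (bit_case (x (i + n))) => e; [left|right]; apply/extendsP; rewrite -e.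
  by case=> /extendsP; rewrite -cats1 => /factor_catl.
have -> : rspecials n = extends bit0 n :&: extends bit1 n.
  apply/setP => w; rewrite finset.in_setI; apply/rspecialsP/andP.
    by case=> *; split; apply/extendsP.
  by case=> /extendsP ? /extendsP ?; split.
rewrite cardsUI.
pose e c (w : n.-tuple 'I_2) := [tuple of rcons w c].
have e_inj c : injective (e c).
  by move=> u v /(congr1 val) /= /rcons_inj[] /val_inj.
have -> : factors n.+1 = e bit0 @: extends bit0 n :|: e bit1 @: extends bit1 n.
  apply/setP => w; rewrite finset.in_setU; apply/factorsP/orP => [|].
    case: w => w; case/lastP: w => // w c wn F.
    have wn' : size w == n by rewrite -eqSS -(size_rcons w c).
    have main : Tuple wn \in e c @: extends c n.
      apply/imsetP; exists (Tuple wn'); last exact: val_inj.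
      exact/extendsP.
    by case: (bit_case c) => ec; [left|right]; rewrite -ec.
  by case=> /imsetP[u] /extendsP F ->.
rewrite cardsU !card_imset // (_ : _ :&: _ = finset.set0) ?cards0 ?subn0 //.
apply/setP => w; rewrite finset.in_setI finset.in_set0.
apply/andP => -[/imsetP[u _ ->] /imsetP[v _]].
by move=> /(congr1 val) /= /rcons_inj[_].
Qed.

End Counting.

Lemma card_rspecials n : #|rspecials q n.+1| = 2.
Proof.
apply/eqP; rewrite eqn_leq; apply/andP; split.
  elim: n => [|n IH].
    by apply: leq_trans (max_card _) _; rewrite card_tuple card_ord.
  apply: leq_trans IH.
  pose bh (w : n.+2.-tuple 'I_2) : n.+1.-tuple 'I_2 := [tuple of behead w].
  have inj : {in rspecials q n.+2 &, injective bh}.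
    move=> u v /rspecialsP ru /rspecialsP rv /(congr1 val) /= E.
    apply: val_inj; move: ru rv E; rewrite /=.
    case: u => -[|a u] //= su; case: v => -[|b v] //= sv ru rv E; subst v.
    have [->//|ab] := eqVneq a b; case: (@no_strong_bispecial_q u).
      by case: u su {sv ru rv}.
    exists a, b, bit0, bit1; split; [exact/eqP|exact/eqP|].
    have [ra0 ra1] := ru; have [rb0 rb1] := rv => l r.
    rewrite !inE => lab _.
    by case: (bit_case r) => ->; case/orP: lab => /eqP ->.
  rewrite -(card_in_imset inj); apply/subset_leq_card/fintype.subsetP => w.
  case/imsetP=> v /rspecialsP rv ->; apply/rspecialsP => /=.
  by case: v rv => -[|a v] //= sv rv; apply: (@rspecial_suffix _ _ _ _ [:: a]).
have [u su [lu ru]] := rspecial_q bit0 n; have [v sv [lv rv]] := rspecial_q bit1 n.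
move/eqP: su => su; move/eqP: sv => sv.
have neq : Tuple su != Tuple sv.
  by apply/eqP => /(congr1 val) /= E; move: lv; rewrite -E lu.
have c2 : 2 <= #|[set Tuple su; Tuple sv]%SET| by rewrite cards2 neq.
apply: leq_trans c2 _; apply/subset_leq_card/fintype.subsetP => w.
by rewrite finset.in_set2 => /orP[]/eqP->; apply/rspecialsP.
Qed.

Lemma rote_q : is_rote q.
Proof.
case=> // n _; elim: n => [|n IH]; last by rewrite complexityS IH card_rspecials; lia.
apply/eqP; rewrite eqn_leq complexityE; apply/andP; split.
  by apply: leq_trans (max_card _) _; rewrite card_tuple card_ord.
apply: (@leq_trans #|rspecials q 1|); first by rewrite card_rspecials.
apply/subset_leq_card/fintype.subsetP => w.
by move=> /rspecialsP[]; rewrite -cats1 => /factor_catl F _; apply/factorsP.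
Qed.

(** * Unavoidable repetitions in words with few factors *)

(** Some prefix of [w] has a period [d] and length at least [5 * d / 2]: its overlap
    has length [uphalf (3 * d)]. *)
Definition high_power (w : seq 'I_2) : bool :=
  has (fun d => take (uphalf (3 * d)) w == take (uphalf (3 * d)) (drop d w))
    (iota 1 (2 * size w %/ 5)).

Definition windows5 (w : seq 'I_2) : seq (seq 'I_2) :=
  [seq take 5 (drop j w) | j <- iota 0 (size w - 4)].

Definition forbidden (w : seq 'I_2) : bool :=
  if high_power w then true else 10 < size (undup (windows5 w)).

(** Depth-first search to the left.  The conditionals, rather than boolean
    connectives, cut off the branches under call-by-value evaluation. *)
Fixpoint unavoidable (n : nat) (w : seq 'I_2) : bool :=
  if forbidden w then true else
  if n is k.+1 then
    if unavoidable k (bit0 :: w) then unavoidable k (bit1 :: w) else false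
  else false.

(** The longest words without any forbidden suffix have length 38. *)
Lemma unavoidable39 : unavoidable 39 [::].
Proof. by vm_compute. Qed.

Lemma unavoidableP n w v : unavoidable n w -> size v = n ->
  exists2 k, k <= n & forbidden (drop k (v ++ w)).
Proof.
elim: n w v => [|n IH] w v /=.
  by case: ifP => // F _ /size0nil->; exists 0; rewrite ?drop0.
case: ifP => [F _ sv|_].
  by exists n.+1 => //; rewrite drop_size_cat.
case: ifP => // U0 U1; case/lastP: v => // v c; rewrite size_rcons => -[sv].
rewrite -cats1 -catA; suff [k le F] : exists2 k, k <= n & forbidden (drop k (v ++ c :: w)).
  by exists k => //; apply: leqW.
by case: (bit_case c) => ->; apply: IH.
Qed.

Lemma size_uniq_factors (x : nat -> 'I_2) n (s : seq (seq 'I_2)) : uniq s ->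
    (forall w, w \in s -> size w = n /\ is_factor w x) ->
  size s <= complexity x n.
Proof.
move=> us sF; pose s' : seq (n.-tuple 'I_2) := pmap insub s.
have s_n w : w \in s -> size w == n by case/sF => ->.
have <- : size s' = size s.
  by rewrite size_pmap_sub; apply/eqP; rewrite -all_count; apply/allP.
rewrite complexityE cardE; apply: uniq_leq_size; first exact: pmap_sub_uniq.
move=> w; rewrite mem_pmap_sub mem_enum => /sF[_ F].
exact/factorsP.
Qed.

Lemma rote_high_power (x : nat -> 'I_2) : is_rote x -> exists k n, high_power (fac x k n).
Proof.
move=> rx; have [k lek] := unavoidableP unavoidable39 (size_fac x 0 39).
rewrite cats0 drop_fac // add0n /forbidden; case: ifP => [F _|_].
  by exists k, (39 - k).
move=> too_many; exfalso; move: too_many; apply/negP; rewrite -leqNgt.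
have <- : complexity x 5 = 10 by apply: rx.
apply: size_uniq_factors; first exact: undup_uniq.
move=> w; rewrite mem_undup => /mapP[j]; rewrite mem_iota size_fac => jle ->.
by rewrite drop_fac ?take_fac ?size_fac; try lia; split=> //; apply: factor_fac.
Qed.

(** * Critical exponents *)

Lemma has_period_fac (A : finType) (x : nat -> A) i n d :
  has_period (fac x i n) d <-> [/\ 0 < d, d <= n & agree x d i (i + n - d)].
Proof.
have E j : j < n -> onth (fac x i n) j = Some (x (i + j)).
  by move=> lt; rewrite onthE (nth_map (x 0)) ?size_fac // nth_fac.
rewrite /has_period size_fac; split=> [/andP[/andP[d0 dn] /forallP ag]|[d0 dn ag]].
  split=> // j jle; have lt : j - i < n - d by lia.
  have /eqP := ag (Ordinal lt); rewrite /= !E; try lia.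
  by case; rewrite addnA subnKC //; case/andP: jle.
rewrite d0 dn; apply/forallP => -[j lt] /=.
by rewrite !E; try lia; rewrite addnA ag //; lia.
Qed.

Lemma exponent_le (A : finType) (R : realType) (z : seq A) : z != [::] ->
  (exponent R z <= 5%:R / 2%:R)%R = (2 * size z <= 5 * shortest_period z).
Proof.
case/shortest_periodP=> /andP[/andP[d0 _] _] _; rewrite /exponent.
by rewrite ler_pdivrMr ?ltr0n // mulrAC ler_pdivlMr ?ltr0n // -!natrM ler_nat mulnC.
Qed.

Lemma exponent_ge (A : finType) (R : realType) (z : seq A) : z != [::] ->
  (5%:R / 2%:R <= exponent R z)%R = (5 * shortest_period z <= 2 * size z).
Proof.
case/shortest_periodP=> /andP[/andP[d0 _] _] _; rewrite /exponent.
by rewrite ler_pdivlMr ?ltr0n // mulrAC ler_pdivrMr ?ltr0n // -!natrM ler_nat [2 * _]mulnC.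
Qed.

Lemma ce_ge (A : finType) (R : realType) (x : nat -> A) i n d :
  0 < d -> 5 * d <= 2 * n -> agree x d i (i + n - d) ->
  ((5%:R / 2%:R)%R%:E <= critical_exponent R x)%E.
Proof.
move=> d0 dn ag; have z0 : fac x i n != [::] by rewrite -size_eq0 size_fac; lia.
apply: le_trans (ereal_sup_ubound _); last first.
  by exists (fac x i n) => //; split=> //; apply: factor_fac.
rewrite lee_fin exponent_ge // size_fac; have [_ minp] := shortest_periodP z0.
have : shortest_period (fac x i n) <= d.
  by apply: minp; apply/has_period_fac; split=> //; lia.
by lia.
Qed.

Lemma ce_le (A : finType) (R : realType) (x : nat -> A) :
  (forall i n d, 0 < d -> d <= n -> agree x d i (i + n - d) -> 2 * n <= 5 * d) ->
  (critical_exponent R x <= (5%:R / 2%:R)%R%:E)%E.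
Proof.
move=> H; apply: ge_ereal_sup => _ [z [z0 [i zE]] <-].
rewrite lee_fin exponent_le //; have [zp _] := shortest_periodP z0.
have {zp} : has_period (fac x i (size z)) (shortest_period z) by rewrite -[fac _ _ _]zE.
by case/has_period_fac=> d0 dn ag; apply: H d0 dn ag.
Qed.

Lemma ce_rote (R : realType) (x : nat -> 'I_2) : is_rote x ->
  ((5%:R / 2%:R)%R%:E <= critical_exponent R x)%E.
Proof.
move=> /rote_high_power[k [n /hasP[d]]]; rewrite mem_iota size_fac => dle.
have h2 : uphalf (3 * d) + d <= n by lia.
rewrite drop_fac ?take_fac; try lia.
move=> /eqP E; apply: (@ce_ge _ _ _ k (uphalf (3 * d) + d) d); try lia.
move=> i ile; have := fac_inj E (k := i - k).
by rewrite -addnA [d + _]addnC addnA subnKC; [apply; lia|lia].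
Qed.

Lemma ce_q (R : realType) : critical_exponent R q = (5%:R / 2%:R)%R%:E.
Proof.
apply/eqP; rewrite eq_le ce_rote; last exact: rote_q.
rewrite andbT ce_le // => i n d d0 dn ag.
by have := q_agree_bound d0 ag; lia.
Qed.

Theorem theorem2 (R : realType) :
  [/\ is_rote q,
      critical_exponent R q = (5%:R / 2%:R)%R%:E
    & repetition_threshold R is_rote = (5%:R / 2%:R)%R%:E ].
Proof.
split; [exact: rote_q|exact: ce_q|].
apply/eqP; rewrite eq_le; apply/andP; split.
  by rewrite -(ce_q R); apply: ereal_inf_lbound; exists q => //; apply: rote_q.
by apply: le_ereal_inf_tmp => _ [x rx <-]; apply: ce_rote.
Qed.
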